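(* Let $T>0$ and $A:\mathbb{R}\to\mathbb{R}^{n\times n}$ continuous and $T$-periodic. The following are equivalent for the system $\dot{\mathbf x}=A(t)\mathbf x$: (a) the A-index of the system is zero; (b) there exist $R\in\mathbb{R}^{n\times n}$ and a $T$-periodic function $Q:\mathbb{R}\to\mathbb{R}^{n\times n}$ such that $Q(t)e^{tR}$ is a fundamental matrix solution of the system; (c) every fundamental matrix solution $\Phi(t)$ of the system admits a real Floquet normal form $\Phi(t)=P(t)e^{tB}$ with $B\in\mathbb{R}^{n\times n}$ and $P:\mathbb{R}\to\mathbb{R}^{n\times n}$ $T$-periodic.
   Context: For a fundamental matrix $\Phi$ of $\dot{\mathbf x}=A(t)\mathbf x$, the monodromy matrix is $\Phi^{-1}(0)\Phi(T)$; its Jordan normal form is independent of $\Phi$. The A-index of the system is the sum, over each distinct Jordan block of the Jordan normal form of a monodromy matrix that is associated to a real negative eigenvalue and occurs an odd number of times, of the dimension of that block (each such distinct block counted only once). *)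

(* Defs.v *)
From HB Require Import structures.
From mathcomp Require Import all_boot all_order all_algebra.
From mathcomp Require Import all_classical all_reals all_analysis.
From mathcomp Require Import complex.

Set Implicit Arguments.
Unset Strict Implicit.
Unset Printing Implicit Defensive.

Import Order.TTheory GRing.Theory Num.Theory.
Import numFieldNormedType.Exports.
Local Open Scope ring_scope.

Definition mexp (R : realType) (n : nat) (M : 'M[R]_n) : 'M[R]_n :=
  \matrix_(i, j) limn (fun N : nat => (\sum_(k < N) ((k`!)%:R^-1 *: M ^+ k)) i j).

Definition periodic_mx (R : realType) (n : nat) (T : R) (F : R -> 'M[R]_n) : Prop :=
  forall t : R, F (t + T) = F t.

Definition continuous_mx (R : realType) (n : nat) (F : R -> 'M[R]_n) : Prop :=
  forall i j : 'I_n, continuous (fun t : R => F t i j).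

Definition fundamental_matrix (R : realType) (n : nat)
    (A : R -> 'M[R]_n) (Phi : R -> 'M[R]_n) : Prop :=
  (forall t : R, Phi t \in unitmx) /\
  (forall (t : R) (i j : 'I_n),
      is_derive t 1 (fun s : R => Phi s i j) ((A t *m Phi t) i j)).

Definition monodromy (R : realType) (n : nat) (T : R) (Phi : R -> 'M[R]_n)
  : 'M[R]_n := invmx (Phi 0) *m Phi T.

Definition jordan_block (C : pzRingType) (l : C) (k : nat) : 'M[C]_k :=
  \matrix_(i, j) (l *+ (i == j :> nat) + ((j : nat) == i.+1)%:R).

Definition jordan_decomp (C : fieldType) (n : nat) (M : 'M[C]_n)
    (m : nat) (lam : 'I_m -> C) (p : 'I_m -> nat) : Prop :=
  (forall i, (0 < p i)%N) /\
  exists (e : (\sum_(i < m) p i)%N = n) (P : 'M[C]_n),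
    P \in unitmx /\
    M = invmx P *m castmx (e, e) (\mxdiag_(i < m) jordan_block (lam i) (p i)) *m P.

Definition block_count (C : eqType) (m : nat) (lam : 'I_m -> C) (p : 'I_m -> nat)
    (i : 'I_m) : nat :=
  #|[set j : 'I_m | (lam j == lam i) && (p j == p i)]|.

(** Sum, over each distinct Jordan block associated with a real negative
    eigenvalue and occurring an odd number of times, of its dimension
    (each distinct block counted once: only its first occurrence is summed). *)
Definition A_index_of_jordan (R : rcfType) (m : nat) (lam : 'I_m -> R[i])
    (p : 'I_m -> nat) : nat :=
  (\sum_(i < m | [&& (lam i \is Num.real), (lam i < 0)%R,
                    odd (block_count lam p i) &
                    [forall j : 'I_m, (j < i)%N ==>
                        ~~ ((lam j == lam i) && (p j == p i))]]) p i)%N.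

Definition A_index_zero (R : realType) (n : nat) (T : R) (A : R -> 'M[R]_n) : Prop :=
  forall Phi : R -> 'M[R]_n, fundamental_matrix A Phi ->
  forall (m : nat) (lam : 'I_m -> R[i]) (p : 'I_m -> nat),
    jordan_decomp (map_mx (fun x : R => (x%:C)%C) (monodromy T Phi)) lam p ->
    A_index_of_jordan lam p = 0%N.

(* Main.v *)
(* A real Floquet normal form exists exactly when the monodromy matrix M has a
   real logarithm, so the theorem reduces to: M = exp L with L real iff every
   Jordan block with a negative eigenvalue occurs an even number of times.
   In terms of N = M - a (a < 0) this parity condition says that
   rank N^k - rank N^(k+1) is even for all k.
   If M = exp L, then M is the square of the real matrix S = exp (L/2), and S
   induces on im N^k / im N^(k+1) an operator of square a < 0, which forces an
   even dimension. Conversely, maximal Jordan blocks with eigenvalue a < 0 can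
   be split off two at a time; on such a pair D one has D = exp (pi K + L), where
   -D = exp L, K^2 = -1 and K commutes with D. When no negative eigenvalue is
   left, the segment from 1 to M is a path of invertible matrices, and integrating
   its logarithmic derivative yields a real logarithm commuting with everything
   that commutes with M.
   Existence for linear systems, the identities of the matrix exponential and the
   logarithm along a path all come from one convergence theorem for Picard series:
   X_0 = 1, X_(k+1)' = A X_k, X_(k+1)(0) = 0. *)

Require Import Defs.
From HB Require Import structures.
From mathcomp Require Import all_boot all_order all_algebra.
From mathcomp Require Import all_classical all_reals all_analysis.
From mathcomp Require Import complex.
From mathcomp Require Import ring lra zify.

Set Implicit Arguments.
Unset Strict Implicit.
Unset Printing Implicit Defensive.

Import Order.TTheory GRing.Theory Num.Theory.
Import numFieldNormedType.Exports.
Local Open Scope classical_set_scope.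
Local Open Scope ring_scope.

(** * Termwise differentiation of dominated series of real functions *)

Section ScalarAnalysis.
Variable R : realType.
Implicit Types (f g u : R -> R).

Lemma is_derive_continuous f (df : R -> R) :
  (forall t : R, is_derive t 1 f (df t)) -> continuous f.
Proof.
move=> fd t; apply/differentiable_continuous/derivable1_diffP.
by have [] := fd t.
Qed.

Lemma within_continuousT f (a b : R) : continuous f -> {within `[a, b], continuous f}.
Proof. by move=> fc; apply: continuous_subspaceT => x; exact: fc. Qed.

Lemma is_derive_nonneg_le f (df : R -> R) (a b : R) : a <= b ->
    (forall t : R, is_derive t 1 f (df t)) ->
    (forall t, a <= t <= b -> 0 <= df t) -> f a <= f b.
Proof.
move=> ab fd df0.
have fc := is_derive_continuous fd.
have [c] := MVT_segment ab (fun x _ => fd x) (within_continuousT fc).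
rewrite in_itv/= => /df0 dfc e.
by rewrite -subr_ge0 e mulr_ge0// subr_ge0.
Qed.

Lemma is_derive_bounded_lipschitz f (df : R -> R) (K B : R) :
    (forall t : R, is_derive t 1 f (df t)) ->
    (forall t, `|t| <= K -> `|df t| <= B) ->
  forall s t, `|s| <= K -> `|t| <= K -> `|f s - f t| <= B * `|s - t|.
Proof.
move=> fd dfB; suff H s t : s <= t -> `|s| <= K -> `|t| <= K ->
    `|f s - f t| <= B * `|s - t|.
  move=> s t sK tK; have [st|/ltW ts] := leP s t; first exact: H.
  by rewrite distrC (distrC s); exact: H.
move=> st sK tK; have fc := is_derive_continuous fd.
have [c] := MVT_segment st (fun x _ => fd x) (within_continuousT fc).
rewrite in_itv/= => /andP[sc ct] e.
rewrite distrC e normrM (distrC s) ler_wpM2r// dfB//.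
by move: sK tK; rewrite !ler_norml => /andP[? ?] /andP[? ?]; lra.
Qed.

Lemma geometric_half_sum_le (C : R) (N m : nat) : 0 <= C ->
  \sum_(N <= k < m) C * 2^-1 ^+ k <= 2 * C * 2^-1 ^+ N.
Proof.
move=> C0; have [Nm|mN] := ltnP N m; last first.
  by rewrite big_geq// !mulr_ge0// exprn_ge0.
suff -> : \sum_(N <= k < m) C * 2^-1 ^+ k
    = 2 * C * 2^-1 ^+ N - 2 * C * 2^-1 ^+ m.
  by rewrite gerBl !mulr_ge0// exprn_ge0.
elim: m Nm => // m IH; rewrite ltnS leq_eqVlt => /predU1P[->|Nm].
  by rewrite big_nat1 exprS; field.
by rewrite big_nat_recr/= ?(ltnW Nm)// IH// exprS; field.
Qed.

Lemma geometric_dominated_series (v : nat -> R) (C : R) :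
    (forall k, `|v k| <= C * 2^-1 ^+ k) ->
  cvgn (fun N => \sum_(k < N) v k) /\
  forall N, `|limn (fun N => \sum_(k < N) v k) - \sum_(k < N) v k|
            <= 2 * C * 2^-1 ^+ N.
Proof.
move=> vC.
have C0 : 0 <= C.
  by have := le_trans (normr_ge0 _) (vC 0%N); rewrite expr0 mulr1.
have e : (fun N => \sum_(k < N) v k) = series v.
  by apply/funext => N; rewrite seriesEord.
have cv : cvgn (series v).
  apply: normed_cvg; apply: (@series_le_cvg _ _ (geometric C 2^-1)).
  - by move=> k; exact: normr_ge0.
  - by move=> k; exact: le_trans (normr_ge0 _) (vC k).
  - exact: vC.
  by apply: is_cvg_geometric_series; rewrite ger0_norm ?invr_ge0// invf_lt1// ltr1n.
rewrite e; split=> // N.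
have h : (fun m => `|series v m - \sum_(k < N) v k|) @ \oo -->
   `|limn (series v) - \sum_(k < N) v k|.
  by apply: cvg_norm; apply: cvgB => //; exact: cvg_cst.
rewrite -(cvg_lim _ h)//; apply: limr_le; first by apply/cvg_ex; eexists; exact: h.
near=> m.
have Nm : (N <= m)%N by near: m; exact: nbhs_infty_ge.
rewrite seriesEnat/= -(big_mkord predT v) (big_cat_nat (leq0n N) Nm)//= addrAC subrr add0r.
apply: le_trans (ler_norm_sum _ _ _) _.
apply: le_trans (geometric_half_sum_le N m C0).
by apply: ler_sum => k _.
Unshelve. all: by end_near. Qed.

Lemma half_expn_small (C e : R) : 0 < e -> exists N : nat, C * 2^-1 ^+ N < e.
Proof.
move=> e0.
have h : (fun N => C * 2^-1 ^+ N) @ \oo --> C * (0 : R).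
  by apply: cvgM; [exact: cvg_cst|apply: cvg_expr; rewrite ger0_norm ?invr_ge0// invf_lt1// ltr1n].
rewrite mulr0 in h.
have /(_ _ _ e0) := cvgr_lt _ h.
by case=> N _ /(_ N (leqnn N)) H; exists N.
Qed.

Lemma is_derive1_quotientP f (t v : R) :
  (h^-1 * (f (h + t) - f t) @[h --> 0^'] --> v) -> is_derive t 1 f v.
Proof.
move=> H.
have e : (fun h : R => h^-1 *: ((f \o shift t) (h *: 1) - f t)) =
         (fun h => h^-1 * (f (h + t) - f t)).
  by apply/funext => h /=; rewrite /GRing.scale/= mulr1.
split; first by rewrite /derivable e; apply/cvg_ex; exists v.
by rewrite /derive e; exact: cvg_lim.
Qed.

Lemma is_derive1_quotient f (t v : R) : is_derive t 1 f v ->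
  (h^-1 * (f (h + t) - f t) @[h --> 0^'] --> v).
Proof.
case=> /[dup] d /cvg_ex[l hl] <-.
have e : (fun h : R => h^-1 *: ((f \o shift t) (h *: 1) - f t)) =
         (fun h => h^-1 * (f (h + t) - f t)).
  by apply/funext => h /=; rewrite /GRing.scale/= mulr1.
rewrite /derive e; rewrite e in hl.
by rewrite (cvg_lim _ hl).
Qed.

(** The bound on [du] makes each [u k] Lipschitz, so the tail of the difference quotient is
    geometrically small uniformly in the increment; the error then splits into three parts of at
    most [e / 3]. *)
Lemma is_derive_series (u du : nat -> R -> R) :
    (forall k (t : R), is_derive t 1 (u k) (du k t)) ->
    (forall K : R, exists C : R, forall k t, `|t| <= K ->
       `|u k t| <= C * 2^-1 ^+ k /\ `|du k t| <= C * 2^-1 ^+ k) ->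
  forall t : R, is_derive t 1 (fun s => limn (fun N => \sum_(k < N) u k s))
     (limn (fun N => \sum_(k < N) du k t)).
Proof.
move=> ud bnd t.
(* The margin 1 keeps [h + t] inside the segment where the bounds hold, for increments [h] of
   modulus at most 1. *)
set K := `|t| + 1.
have [C HC] := bnd K.
have C0 : 0 <= C.
  have [/(le_trans (normr_ge0 _))] : `|u 0%N 0| <= C * 2^-1 ^+ 0 /\ `|du 0%N 0| <= C * 2^-1 ^+ 0.
    by apply: HC; rewrite normr0 /K addr_ge0.
  by rewrite expr0 mulr1.
have tK : `|t| <= K by rewrite /K lerDl.
set F := fun s => limn _.
apply: is_derive1_quotientP; apply/cvgrPdist_le => e e0.
have [N HN] := half_expn_small (2 * C) (divr_gt0 e0 (ltr0n R 3)).
set SN := fun s => \sum_(k < N) u k s.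
set v := limn _.
have [_ /(_ N) dv] := geometric_dominated_series (fun k => (HC k t tK).2).
rewrite -/v in dv.
have dSN : is_derive t 1 SN (\sum_(k < N) du k t).
  rewrite (_ : SN = \sum_(k < N) u k); first exact: is_derive_sum.
  by apply/funext => s; rewrite fct_sumE.
have /cvgrPdist_le /(_ _ (divr_gt0 e0 (ltr0n R 3))) Hq := is_derive1_quotient dSN.
near=> h.
have h0 : h != 0 by near: h; exact: nbhs_dnbhs_neq.
have hK : `|h + t| <= K.
  rewrite /K addrC (le_trans (ler_normD _ _))// lerD2l.
  near: h; apply: dnbhs0_le; exact: ltr01.
have q : `| \sum_(k < N) du k t - h^-1 * (SN (h + t) - SN t)| <= e / 3.
  by near: h; exact: Hq.
have tail : `|(F (h + t) - F t) - (SN (h + t) - SN t)| <= 2 * (C * `|h|) * 2^-1 ^+ N.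
  have lip k : `|u k (h + t) - u k t| <= (C * `|h|) * 2^-1 ^+ k.
    have := is_derive_bounded_lipschitz (ud k) (fun t tK => (HC k t tK).2) hK tK.
    by rewrite addrK; rewrite mulrAC.
  have [_ /(_ N)] := geometric_dominated_series lip.
  have [c1 _] := geometric_dominated_series (fun k => (HC k _ hK).1).
  have [c2 _] := geometric_dominated_series (fun k => (HC k _ tK).1).
  rewrite /SN -sumrB; congr (`|_ - _| <= _).
  rewrite /F -limB//; congr (limn _); apply/funext => m.
  by rewrite fctE sumrB.
have -> : v - h^-1 * (F (h + t) - F t) =
   (v - \sum_(k < N) du k t) + (\sum_(k < N) du k t - h^-1 * (SN (h + t) - SN t))
   - h^-1 * ((F (h + t) - F t) - (SN (h + t) - SN t)) by ring.
have T3 : `|h^-1 * ((F (h + t) - F t) - (SN (h + t) - SN t))| <= e / 3.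
  rewrite normrM normfV ler_pdivrMl ?normr_gt0//.
  apply: le_trans tail _.
  rewrite (_ : 2 * (C * `|h|) * 2^-1 ^+ N = `|h| * (2 * C * 2^-1 ^+ N)); last by ring.
  by rewrite ler_wpM2l// ltW.
have T1 := le_trans dv (ltW HN).
apply: le_trans (ler_normB _ _) _.
apply: le_trans (lerD (le_trans (ler_normD _ _) (lerD T1 q)) T3) _.
lra.
Unshelve. all: by end_near. Qed.

End ScalarAnalysis.

(** * Antiderivatives on the whole line and an exponentially weighted estimate *)

Section Antiderivative.
Variable R : realType.

Lemma is_derive0_itv_cst (f : R -> R) (a b x y : R) :
    (forall t : R, a < t < b -> is_derive t 1 f 0) ->
  a < x < b -> a < y < b -> f x = f y.
Proof.
move=> fd; suff H x' y' : x' <= y' -> a < x' < b -> a < y' < b -> f x' = f y'.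
  by move=> xab yab; have [xy|/ltW yx] := leP x y; [|symmetry]; exact: H.
move=> xy /andP[ax xb] /andP[ay yb].
have fd' t : t \in `[x', y']%R -> is_derive t 1 f 0.
  by rewrite in_itv/= => /andP[xt ty]; apply: fd; rewrite (lt_le_trans ax)//= (le_lt_trans ty).
have fc : {within `[x', y'], continuous f}.
  by apply: derivable_within_continuous => t /fd' [].
have fd0 t : t \in `]x', y'[%R -> is_derive t 1 f ((fun=> 0) t).
  by move=> /subset_itv_oo_cc/fd'.
have [c _] := MVT_segment xy fd0 fc.
by rewrite mul0r => /eqP; rewrite subr_eq0 => /eqP.
Qed.

(** The fundamental theorem of calculus applies on each segment from [- K] to [K]; the primitives,
    normalised at 0, agree on overlaps and glue to one on the line. *)
Lemma continuous_antiderivative (f : R -> R) : continuous f ->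
  exists2 G : R -> R, (forall t : R, is_derive t 1 G (f t)) & G 0 = 0.
Proof.
move=> fc.
pose mu := @lebesgue_measure R.
pose F (K x : R) := (\int[mu]_(s in [set` `[(- K), x]]) f s)%R.
have dF (K x : R) : - K < x < K -> is_derive x 1 (F K) (f x).
  move=> /andP[Kx xK].
  have fi : mu.-integrable `[(- K), K] (EFin \o f).
    apply: continuous_compact_integrable; first exact: segment_compact.
    exact: within_continuousT.
  have [d e] := continuous_FTC1_closed xK fi Kx (fc x).
  by split; [exact: d|rewrite -derive1E; exact: e].
pose H K x := F K x - F K 0.
have dH (K x : R) : - K < x < K -> is_derive x 1 (H K) (f x).
  move=> /dF Hd; rewrite /H -[f x]subr0; exact: is_deriveB.
have consistent (K K' x : R) : K <= K' -> - K < x < K -> H K x = H K' x.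
  move=> KK' /andP[Kx xK].
  pose d := H K \- H K'.
  suff e : d x = d 0 by apply/eqP; rewrite -subr_eq0 -[_ - _]/(d x) e /d /H/= !subrr.
  apply: (@is_derive0_itv_cst d (- K) K) => [t tK||].
  - rewrite -(subrr (f t)); apply: is_deriveB; apply: dH => //.
    by move: tK => /andP[? ?]; apply/andP; split; lra.
  - by rewrite Kx.
  - by apply/andP; split; lra.
exists (fun x => H (`|x| + 1) x); last by rewrite /H subrr.
move=> t.
apply: (@near_eq_is_derive _ _ _ (H (`|t| + 2))).
- near=> s.
  have st : `|t - s| < 1 by near: s; apply: cvgr_dist_lt => //; exact: ltr01.
  have ss := ler_normB t (t - s); rewrite subKr in ss.
  have ns : `|s| + 1 <= `|t| + 2.
    rewrite (_ : 2 = 1 + 1)// addrA lerD2r (le_trans ss)// lerD2l.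
    exact: ltW.
  apply/esym/consistent => //; apply/andP; split.
    by rewrite ltrNl (le_lt_trans (ler_norm _))// normrN ltrDl.
  by rewrite (le_lt_trans (ler_norm _))// ltrDl.
- apply: dH; apply/andP; split.
    by rewrite ltrNl (le_lt_trans (ler_norm _))// normrN ltrDl.
  by rewrite (le_lt_trans (ler_norm _))// ltrDl.
Unshelve. all: by end_near. Qed.

(* Weighting by [exp (2 c |t|)] makes integration against [c] a contraction
   of ratio 1/2. *)
Lemma exp_weight_contraction (f df : R -> R) (K c C : R) : 0 <= C ->
    (forall t : R, is_derive t 1 f (df t)) -> f 0 = 0 ->
    (forall t : R, `|t| <= K -> `|df t| <= c * C * expR (2 * c * `|t|)) ->
  forall t : R, `|t| <= K -> `|f t| <= C / 2 * expR (2 * c * `|t|).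
Proof.
move=> C0.
(* An upper bound for [t >= 0] suffices: it is applied to [f], to [- f] and to their reflections in
   0. *)
suff H (g dg : R -> R) : (forall t : R, is_derive t 1 g (dg t)) -> g 0 = 0 ->
    (forall t : R, `|t| <= K -> dg t <= c * C * expR (2 * c * `|t|)) ->
    forall t : R, 0 <= t -> `|t| <= K -> g t <= C / 2 * expR (2 * c * `|t|).
  move=> fd f0 fb.
  have dN : forall t : R, is_derive t 1 (fun s => f (- s)) (- df (- t)).
    move=> t; have := @is_derive1_comp _ f (-%R) t _ _ (fd (- t)) _.
    by move=> /(_ _ _)/is_derive_eq; apply; rewrite mulrN1.
  have nb (t : R) : `|t| <= K -> - df t <= c * C * expR (2 * c * `|t|).
    by move=> /fb; apply: le_trans; rewrite -normrN ler_norm.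
  have pb (t : R) : `|t| <= K -> df t <= c * C * expR (2 * c * `|t|).
    by move=> /fb; apply: le_trans; rewrite ler_norm.
  have N0 : f (- 0) = 0 by rewrite oppr0.
  have dNN (t : R) : is_derive t 1 (\- f) (- df t) by exact: is_deriveN.
  have dNN' (t : R) : is_derive t 1 (fun s => - f (- s)) (- - df (- t)).
    exact: is_deriveN.
  move=> t tK; rewrite ler_norml; apply/andP; split.
    rewrite lerNl; have [t0|t0] := leP 0 t.
      by apply: (H (\- f) (fun t => - df t)) => //=; rewrite f0 oppr0.
    rewrite -{1}(opprK t) -normrN.
    apply: (H (fun s => - f (- s)) (fun t => - - df (- t))) => //=.
    - by rewrite N0 oppr0.
    - by move=> s sK; rewrite opprK -normrN pb// normrN.
    - by rewrite oppr_ge0 ltW.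
    - by rewrite normrN.
  have [t0|t0] := leP 0 t; first exact: (H f df).
  rewrite -{1}(opprK t) -normrN.
  apply: (H (fun s => f (- s)) (fun t => - df (- t))) => //=.
  - by move=> s sK; rewrite -normrN nb// normrN.
  - by rewrite oppr_ge0 ltW.
  - by rewrite normrN.
move=> gd g0 gb t t0 tK.
(* The derivative of the comparison function is exactly the bound assumed on [dg], so [h] does not
   decrease from [h 0 = C / 2]. *)
pose h s := C / 2 * expR (2 * c * s) - g s.
have dh (s : R) : is_derive s 1 h (c * C * expR (2 * c * s) - dg s).
  apply: is_deriveB.
  have d1 : is_derive s 1 (fun u : R => 2 * c * u) (2 * c).
    by apply: is_derive_eq (is_deriveZ _ (is_derive_id s 1)) _; exact: mulr1.
  have d2 : is_derive s 1 (fun u : R => expR (2 * c * u)) (2 * c * expR (2 * c * s)).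
    by apply: is_derive_eq (is_derive1_comp (is_derive_expR _) d1) _; rewrite mulrC.
  by apply: is_derive_eq (is_deriveZ (C / 2) d2) _; rewrite /GRing.scale/=; field.
have h0t : h 0 <= h t.
  apply: (is_derive_nonneg_le t0 dh) => s /andP[s0 st].
  rewrite subr_ge0; have := gb s; rewrite (ger0_norm s0); apply.
  by rewrite (le_trans st)// (le_trans (ler_norm t)).
have : 0 <= h 0 by rewrite /h g0 subr0 mulr_ge0 ?expR_ge0// divr_ge0.
by move=> /le_trans/(_ h0t); rewrite /h subr_ge0 (ger0_norm t0).
Qed.

End Antiderivative.

(** * Similarity, ranks of powers and splitting off Jordan blocks *)

Section Similarity.
Variable F : fieldType.

Lemma mulmx_expr_r n (N : 'M[F]_n) k : N ^+ k *m N = N ^+ k.+1.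
Proof. by rewrite exprSr. Qed.

Lemma mulmx_expr_l n (N : 'M[F]_n) k : N *m N ^+ k = N ^+ k.+1.
Proof. by rewrite exprS. Qed.

Lemma col_mulmx m n p (A : 'M[F]_(m, n)) (B : 'M[F]_(n, p)) j :
  col j (A *m B) = A *m col j B.
Proof. by rewrite !colE mulmxA. Qed.

(** The sizes may be equal only propositionally, as happens with sums of block sizes; rectangular
    [P] and [Q] avoid casts, and [mxsim_dim] recovers the equality. *)
Definition mxsim n1 n2 (A : 'M[F]_n1) (B : 'M[F]_n2) : Prop :=
  exists (P : 'M[F]_(n1, n2)) (Q : 'M[F]_(n2, n1)),
    [/\ P *m Q = 1%:M, Q *m P = 1%:M & A = P *m B *m Q].

Lemma mxsim_refl n (A : 'M[F]_n) : mxsim A A.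
Proof. by exists 1%:M, 1%:M; rewrite !mulmx1 mul1mx. Qed.

Lemma mxsim_sym n1 n2 (A : 'M[F]_n1) (B : 'M[F]_n2) : mxsim A B -> mxsim B A.
Proof.
move=> [P [Q [PQ QP ->]]]; exists Q, P; split=> //.
by rewrite !mulmxA QP mul1mx -mulmxA QP mulmx1.
Qed.

Lemma mxsim_trans n1 n2 n3 (A : 'M[F]_n1) (B : 'M[F]_n2) (D : 'M[F]_n3) :
  mxsim A B -> mxsim B D -> mxsim A D.
Proof.
move=> [P [Q [PQ QP ->]]] [P' [Q' [PQ' QP' ->]]].
exists (P *m P'), (Q' *m Q); split; last by rewrite !mulmxA.
  by rewrite mulmxA -(mulmxA P) PQ' mulmx1.
by rewrite mulmxA -(mulmxA Q') QP mulmx1.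
Qed.

Lemma mxsim_cast n1 n2 (e : n1 = n2) (A : 'M[F]_n1) : mxsim (castmx (e, e) A) A.
Proof. by case: n2 / e; rewrite castmx_id; exact: mxsim_refl. Qed.

Lemma mxsim_block n1 n2 m1 m2 (A : 'M[F]_n1) (A' : 'M[F]_n2) (B : 'M[F]_m1) (B' : 'M[F]_m2) :
  mxsim A A' -> mxsim B B' -> mxsim (block_mx A 0 0 B) (block_mx A' 0 0 B').
Proof.
move=> [P [Q [PQ QP ->]]] [P' [Q' [PQ' QP' ->]]].
exists (block_mx P 0 0 P'), (block_mx Q 0 0 Q'); split;
  rewrite !mulmx_block !(mulmx0, mul0mx, addr0, add0r) ?PQ ?QP ?PQ' ?QP' //.
- by rewrite -scalar_mx_block.
- by rewrite -scalar_mx_block.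
Qed.

Lemma mxsim_dim n1 n2 (A : 'M[F]_n1) (B : 'M[F]_n2) : mxsim A B -> n1 = n2.
Proof.
move=> [P [Q [PQ QP _]]]; apply/eqP; rewrite eqn_leq; apply/andP; split.
  by rewrite -(mxrank1 F n1) -PQ (leq_trans (mxrankM_maxl _ _)) ?rank_leq_col.
by rewrite -(mxrank1 F n2) -QP (leq_trans (mxrankM_maxl _ _)) ?rank_leq_col.
Qed.

Lemma mxsim_shift_exp n1 n2 (A : 'M[F]_n1) (B : 'M[F]_n2) (l : F) k :
  mxsim A B -> mxsim ((A - l%:M) ^+ k) ((B - l%:M) ^+ k).
Proof.
move=> [P [Q [PQ QP ->]]]; exists P, Q; split=> //.
have e : P *m B *m Q - l%:M = P *m (B - l%:M) *m Q.
  by rewrite mulmxBr mulmxBl mul_mx_scalar -scalemxAl PQ scalemx1.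
rewrite e; elim: k => [|k IH]; first by rewrite !expr0 mulmx1 PQ.
by rewrite !exprS IH -!mulmxE !mulmxA -(mulmxA _ Q P) QP mulmx1.
Qed.

Lemma mxsim_rank n1 n2 (A : 'M[F]_n1) (B : 'M[F]_n2) : mxsim A B -> \rank A = \rank B.
Proof.
suff H n n' (A' : 'M[F]_n) (B' : 'M[F]_n') : mxsim A' B' -> (\rank A' <= \rank B')%N.
  by move=> AB; apply/eqP; rewrite eqn_leq !H//; exact: mxsim_sym.
move=> [P [Q [_ _ ->]]].
by rewrite (leq_trans (mxrankM_maxl _ _))// mxrankM_maxr.
Qed.

Lemma mxrank_shift_exp_sim n1 n2 (A : 'M[F]_n1) (B : 'M[F]_n2) (l : F) k :
  mxsim A B -> \rank ((A - l%:M) ^+ k) = \rank ((B - l%:M) ^+ k).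
Proof. by move=> AB; apply: mxsim_rank; exact: mxsim_shift_exp. Qed.

Lemma block_diag_shift_exp n1 n2 (A : 'M[F]_n1) (B : 'M[F]_n2) (l : F) k :
  (block_mx A 0 0 B - l%:M) ^+ k =
  block_mx ((A - l%:M) ^+ k) 0 0 ((B - l%:M) ^+ k).
Proof.
rewrite (scalar_mx_block n1 n2) opp_block_mx add_block_mx !oppr0 !addr0.
elim: k => [|k IH]; first by rewrite !expr0 -scalar_mx_block.
by rewrite !exprS IH -!mulmxE mulmx_block !(mulmx0, mul0mx, addr0, add0r).
Qed.

Lemma mxrank_block_shift_exp n1 n2 (A : 'M[F]_n1) (B : 'M[F]_n2) (l : F) k :
  \rank ((block_mx A 0 0 B - l%:M) ^+ k) =
  (\rank ((A - l%:M) ^+ k) + \rank ((B - l%:M) ^+ k))%N.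
Proof. by rewrite block_diag_shift_exp rank_diag_block_mx. Qed.

Lemma jordan_block_shift (l a : F) k :
  jordan_block l k - a%:M = jordan_block (l - a) k.
Proof.
apply/matrixP => i j; rewrite !mxE -val_eqE/=.
by case: (i == j :> nat); rewrite ?mulr1n ?mulr0n ?subr0// addrAC.
Qed.

Lemma jordan_block_add (l : F) k : jordan_block l k = jordan_block 0 k + l%:M.
Proof. by rewrite -(subrr l) -jordan_block_shift subrK. Qed.

Lemma jordan_block0_exp k j :
  jordan_block (0 : F) k ^+ j = \matrix_(a, b) ((b : nat) == a + j)%N%:R.
Proof.
elim: j => [|j IH].
  by apply/matrixP => a b; rewrite expr0 !mxE addn0 eq_sym.
apply/matrixP => a b; rewrite exprSr IH -mulmxE !mxE.
under eq_bigr do rewrite !mxE mul0rn add0r.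
have [lt|ge] := ltnP (a + j)%N k.
  rewrite (bigD1 (Ordinal lt))//= eqxx mul1r addnS big1 ?addr0// => c.
  by rewrite -val_eqE/= => /negPf ->; rewrite mul0r.
rewrite big1 => [|c _].
  by case: eqP => // e; have := ltn_ord b; lia.
by case: eqP => [e|]; rewrite ?mul0r//; have := ltn_ord c; lia.
Qed.

Lemma rank_jordan_block0_exp k j : \rank (jordan_block (0 : F) k ^+ j) = (k - j)%N.
Proof.
have kj : (k - j <= k)%N by rewrite leq_subr.
rewrite jordan_block0_exp; set S := \matrix_(_, _) _.
apply/eqP; rewrite eqn_leq; apply/andP; split.
  (* Only the first [k - j] rows of [S] are nonzero, which bounds the rank above; the lower bound
     comes from [S *m S^T]. *)
  have -> : S = pid_mx (k - j) *m S.
    apply/matrixP => a b; rewrite !mxE (bigD1 a)//= !mxE eqxx/= big1 ?addr0.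
      case: ltnP => h; rewrite ?mul1r// mul0r.
      by case: eqP => // e; have := ltn_ord b; lia.
    move=> c ca; rewrite !mxE; case: eqP; rewrite /= ?mul0r// => /val_inj e.
    by rewrite e eqxx in ca.
  by rewrite (leq_trans (mxrankM_maxl _ _))// rank_pid_mx.
suff e : S *m S^T = pid_mx (k - j).
  by rewrite -{1}(rank_pid_mx F kj kj) -e mxrankM_maxl.
apply/matrixP => a b; rewrite !mxE.
have [lt|ge] := ltnP a (k - j)%N; last first.
  rewrite andbF big1// => c _; rewrite !mxE.
  by case: eqP => [e|]; rewrite ?mul0r//; have := ltn_ord c; lia.
have aj : (a + j < k)%N by lia.
rewrite (bigD1 (Ordinal aj))//= !mxE/= eqxx mul1r big1 ?addr0.
  by rewrite andbT eqn_add2r.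
move=> c; rewrite -val_eqE/= => /negPf ca; rewrite !mxE.
by rewrite ca mul0r.
Qed.

Lemma jordan_block_unitmx (l : F) k : l != 0 -> jordan_block l k \in unitmx.
Proof.
move=> l0; rewrite -unitmx_tr unitmxE det_trig.
  rewrite unitfE; apply/prodf_neq0 => i _.
  by rewrite !mxE eqxx mulr1n (_ : (_ == _.+1) = false) ?addr0//; apply/eqP; lia.
apply/is_trig_mxP => i j ij; rewrite !mxE.
rewrite (_ : (_ == _) = false); last by apply/eqP; lia.
rewrite (_ : (_ == _) = false) ?mulr0n ?addr0//; by apply/eqP; lia.
Qed.

Lemma unitmxX n (A : 'M[F]_n) k : A \in unitmx -> A ^+ k \in unitmx.
Proof.
move=> uA; elim: k => [|k IH]; first by rewrite expr0 unitmx1.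
by rewrite exprS -mulmxE unitmx_mul uA.
Qed.

Lemma rank_jordan_block_exp (l : F) k j :
  \rank (jordan_block l k ^+ j) = (if l == 0%R then k - j else k)%N.
Proof.
case: eqVneq => [->|l0]; first exact: rank_jordan_block0_exp.
by rewrite mxrank_unit// unitmxX// jordan_block_unitmx.
Qed.

(* An M-invariant row space [U] and an M-invariant kernel [ker C] that are
   complementary because the Gram-type matrix [U C] is invertible. *)
Lemma mxsim_split k n (M : 'M[F]_n) (U : 'M[F]_(k, n)) (C : 'M[F]_(n, k)) (J : 'M[F]_k) :
    U *m C \in unitmx -> U *m M = J *m U -> M *m C = C *m J ->
  exists (n' : nat) (M' : 'M[F]_n'), mxsim M (block_mx J 0 0 M').
Proof.
move=> uUC UM MC.
set C' := C *m invmx (U *m C).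
have UC' : U *m C' = 1%:M by rewrite mulmxA mulmxV.
set K := row_base (kermx C).
have KC : K *m C = 0 by apply/sub_kermxP; rewrite eq_row_base.
have KC' : K *m C' = 0 by rewrite mulmxA KC mul0mx.
(* [1%:M - C' *m U] is the projection onto the kernel of [C] along [U]; [X] writes it in the basis
   [K], so that [row_mx C' X] and [col_mx U K] are mutually inverse. *)
set X := (1%:M - C' *m U) *m pinvmx K.
have XK : X *m K = 1%:M - C' *m U.
  apply: mulmxKpV; rewrite eq_row_base; apply/sub_kermxP.
  by rewrite mulmxBl mul1mx -!mulmxA mulVmx// mulmx1 subrr.
have KX : K *m X = 1%:M.
  by rewrite /X mulmxA mulmxBr mulmx1 (mulmxA K) KC' mul0mx subr0 mulmxVp// row_base_free.
have UX : U *m X = 0.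
  by rewrite /X mulmxA mulmxBr mulmx1 (mulmxA U) UC' mul1mx subrr mul0mx.
set M' := K *m M *m X.
have KM : K *m M = M' *m K.
  rewrite /M' -(mulmxA (K *m M)) XK mulmxBr mulmx1 -[K *m M *m (C' *m U)]mulmxA (mulmxA M).
  by rewrite /C' (mulmxA M) MC !mulmxA KC !mul0mx subr0.
clearbody M' X C' K; exists _, M', (row_mx C' X), (col_mx U K); split.
- by rewrite mul_row_col XK addrC subrK.
- by rewrite mul_col_row UC' UX KX KC' -scalar_mx_block.
- rewrite mul_row_block !mulmx0 addr0 add0r mul_row_col -!mulmxA -UM -KM !mulmxA.
  by rewrite -mulmxDl XK addrC subrK mul1mx.
Qed.

Lemma expmx_comm n (A B : 'M[F]_n) k : A *m B = B *m A -> A *m B ^+ k = B ^+ k *m A.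
Proof. by move=> AB; apply: commrX; exact: AB. Qed.

(* [k] is the index at which the powers of [M - l] stabilise. If the pairing
   (v, w) |-> v N^(k-1) w vanished on ker N^k x coker N^k, then
   (ker N^k) N^(k-1) would lie in the image of N^k, forcing ker N^k = ker N^(k-1). *)
Lemma mxsim_split_jordan n (M : 'M[F]_n) (l : F) (k : nat) :
    (\rank ((M - l%:M) ^+ k.+1) < \rank ((M - l%:M) ^+ k))%N ->
    \rank ((M - l%:M) ^+ k.+2) = \rank ((M - l%:M) ^+ k.+1) ->
  exists (n' : nat) (M' : 'M[F]_n'),
    mxsim M (block_mx (jordan_block l k.+1) 0 0 M').
Proof.
set N := M - l%:M => lt eq.
have sk1 : (kermx (N ^+ k.+2) <= kermx (N ^+ k.+1))%MS.
  have := mxrank_leqif_sup (_ : kermx (N ^+ k.+1) <= kermx (N ^+ k.+2))%MS.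
  case; first by apply/sub_kermxP; rewrite (exprSr _ k.+1) -mulmxE mulmxA mulmx_ker mul0mx.
  by move=> _ <-; rewrite !mxrank_ker eq.
have : kermx (N ^+ k.+1) *m N ^+ k *m cokermx (N ^+ k.+1) != 0.
  apply/negP => /eqP H0.
  (* The stabilising index is [k.+1] here. Since [u N^(k+2) = 0], stability of the kernels gives
     [u N^(k+1) = 0], which puts ker [N^(k+1)] inside ker [N^k], against [lt]. *)
  have /submxP[u Hu] : (kermx (N ^+ k.+1) *m N ^+ k <= N ^+ k.+1)%MS.
    by rewrite submxE H0.
  have /sub_kermxP : (u <= kermx (N ^+ k.+1))%MS.
    apply: submx_trans sk1; apply/sub_kermxP.
    rewrite (exprSr _ k.+1) -mulmxE mulmxA -Hu -mulmxA.
    by rewrite mulmx_expr_r mulmx_ker.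
  rewrite -Hu => /sub_kermxP /mxrankS; rewrite !mxrank_ker.
  by have := rank_leq_row (N ^+ k); lia.
move=> /matrix0Pn[i [j]]; set a := _ i j => a0.
set v := row i (kermx (N ^+ k.+1)).
set w := col j (cokermx (N ^+ k.+1)).
have vN q : (k < q)%N -> v *m N ^+ q = 0.
  move=> kq; rewrite -(subnKC kq) exprD -mulmxE mulmxA.
  by rewrite /v -row_mul mulmx_ker row0 mul0mx.
have Nw q : (k < q)%N -> N ^+ q *m w = 0.
  move=> kq; rewrite -(subnK kq) exprD -mulmxE -mulmxA.
  by rewrite /w -col_mulmx mulmx_coker col0 mulmx0.
have vwE : v *m N ^+ k *m w = a%:M.
  apply/matrixP => x y; rewrite !ord1 [RHS]mxE eqxx mulr1n /v /w.
  by rewrite -!row_mul -col_mulmx [LHS]mxE [LHS]mxE.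
(* [U] is a Jordan chain of rows built on [v] and [C] one of columns built on [w]; the reversed
   exponent [k - q] makes both realise the same Jordan block. *)
pose U := \matrix_(p < k.+1) (v *m N ^+ p).
pose C := \matrix_(p < n, q < k.+1) (N ^+ (k - q) *m w) p 0.
have colC q : col q C = N ^+ (k - q) *m w.
  by apply/matrixP => x y; rewrite !mxE !ord1.
have rowU p : row p U = v *m N ^+ p by rewrite rowK.
have UN : U *m N = jordan_block 0 k.+1 *m U.
  apply/row_matrixP => p; rewrite !row_mul rowU -mulmxA mulmx_expr_r.
  apply/matrixP => x y; rewrite ord1 [RHS]mxE.
  under eq_bigr do rewrite [row _ _ _ _]mxE [jordan_block _ _ _ _]mxE mul0rn add0r.
  have [lt'|ge] := ltnP p.+1 k.+1.
    rewrite (bigD1 (Ordinal lt'))//= eqxx mul1r big1 ?addr0 => [|c]; first by rewrite [RHS]mxE.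
    by rewrite -val_eqE/= => /negPf ->; rewrite mul0r.
  rewrite big1 => [|c _]; first by rewrite vN// mxE.
  by case: eqP => [e|]; rewrite ?mul0r//; have := ltn_ord c; lia.
have NC : N *m C = C *m jordan_block 0 k.+1.
  apply/matrixP => x q.
  have -> : (N *m C) x q = (N *m col q C) x 0.
    by rewrite -col_mulmx [RHS]mxE.
  rewrite colC mulmxA mulmx_expr_l [RHS]mxE.
  under eq_bigr do rewrite [jordan_block _ _ _ _]mxE mul0rn add0r.
  case: q => [[|q] lq] /=.
    rewrite subn0 Nw ?ltnS// mxE big1// => c _.
    by rewrite mulr0.
  rewrite (bigD1 (Ordinal (ltnW lq)))//= eqxx mulr1 big1 ?addr0.
    by rewrite [RHS]mxE/= -subSn// subSS.
  move=> c; rewrite -val_eqE/= eqSS eq_sym => /negPf ->; by rewrite mulr0.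
have UC p q : (U *m C) p q = (v *m N ^+ (p + (k - q)) *m w) 0 0.
  have -> : (U *m C) p q = (row p U *m col q C) 0 0.
    by rewrite -row_mul -col_mulmx [RHS]mxE [RHS]mxE.
  by rewrite rowU colC exprD -mulmxE !mulmxA.
(* Entry (p, q) of [U *m C] is [v N^(k + p - q) w]: it vanishes below the diagonal and equals [a] on
   it. *)
have uUC : U *m C \in unitmx.
  rewrite -unitmx_tr unitmxE det_trig.
    rewrite unitfE; apply/prodf_neq0 => p _.
    by rewrite mxE UC subnKC -1?ltnS// vwE mxE eqxx mulr1n.
  apply/is_trig_mxP => p q pq; rewrite mxE UC vN ?mul0mx ?mxE//.
  by have := ltn_ord q; lia.
have MN : M = N + l%:M by rewrite subrK.
apply: (mxsim_split uUC).
  by rewrite jordan_block_add MN mulmxDr UN mulmxDl mul_mx_scalar mul_scalar_mx.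
by rewrite jordan_block_add MN mulmxDl NC mulmxDr mul_mx_scalar mul_scalar_mx.
Qed.

(** Ranks cannot drop at every step, so there is a first repetition. As [N] is singular it does not
    occur at index 0, and [k] is the step just before it. *)
Lemma rank_exp_stabilizes n (N : 'M[F]_n) : N \notin unitmx ->
  exists k, (\rank (N ^+ k.+1) < \rank (N ^+ k))%N /\
            \rank (N ^+ k.+2) = \rank (N ^+ k.+1).
Proof.
move=> nN.
have mono k : (\rank (N ^+ k.+1) <= \rank (N ^+ k))%N.
  by rewrite exprS -mulmxE mxrankM_maxr.
have r1 : (\rank (N ^+ 1) < \rank (N ^+ 0))%N.
  rewrite expr1 expr0 mxrank1 ltn_neqAle rank_leq_row andbT.
  by apply/negP => rf; case/negP: nN; rewrite -row_free_unit.
have ex : exists k, \rank (N ^+ k.+1) == \rank (N ^+ k).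
  apply: contrapT => /forallNP H.
  have lt k : (\rank (N ^+ k) + k <= n)%N.
    elim: k => [|k IH]; first by rewrite addn0 rank_leq_row.
    by have := H k; have := mono k; lia.
  by have := lt n.+1; lia.
case: (ex_minnP ex) => -[|k] /eqP e mn; first by move: r1; rewrite e ltnn.
exists k; split=> //; have := mono k; rewrite leq_eqVlt => /orP[h|//].
by have := mn _ h; rewrite ltnn.
Qed.

Lemma eigen_split n (M : 'M[F]_n) (l : F) : M - l%:M \notin unitmx ->
  exists (k n' : nat) (M' : 'M[F]_n'),
    mxsim M (block_mx (jordan_block l k.+1) 0 0 M').
Proof.
move=> /rank_exp_stabilizes[k [lt e]].
by have [n' [M' h]] := mxsim_split_jordan lt e; exists k, n', M'.
Qed.

End Similarity.

(** * Entrywise calculus of matrix functions and Picard series *)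

Section MatrixCalculus.
Variable R : realType.

(** Kept entrywise so that the differential equation inside [fundamental_matrix] is convertible to
    it. *)
Definition mx_derive m n (X : R -> 'M[R]_(m, n)) (t : R) (D : 'M[R]_(m, n)) : Prop :=
  forall i j, is_derive t 1 (fun s : R => X s i j) (D i j).

Lemma mx_derive_eq m n (X : R -> 'M[R]_(m, n)) t D D' :
  mx_derive X t D -> D = D' -> mx_derive X t D'.
Proof. by move=> + <-. Qed.

Lemma mx_derive_cst m n (C : 'M[R]_(m, n)) t : mx_derive (fun=> C) t 0.
Proof. by move=> i j; rewrite mxE; exact: is_derive_cst. Qed.

Lemma mx_deriveD m n (X Y : R -> 'M[R]_(m, n)) t D E :
  mx_derive X t D -> mx_derive Y t E -> mx_derive (fun s => X s + Y s) t (D + E).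
Proof.
move=> XD YE i j.
rewrite (_ : (fun s => _) = (fun s => X s i j) \+ (fun s => Y s i j)).
  by rewrite mxE; exact: is_deriveD.
by apply/funext => s; rewrite mxE.
Qed.

Lemma mx_deriveM m n p (X : R -> 'M[R]_(m, n)) (Y : R -> 'M[R]_(n, p)) t D E :
    mx_derive X t D -> mx_derive Y t E ->
  mx_derive (fun s => X s *m Y s) t (D *m Y t + X t *m E).
Proof.
move=> XD YE i j.
rewrite (_ : (fun s => _) = \sum_(l < n) ((fun s => X s i l) * (fun s => Y s l j))).
  rewrite (_ : _ i j = \sum_(l < n) (X t i l *: E l j + Y t l j *: D i l)).
    by apply: is_derive_sum => l; apply: is_deriveM.
  rewrite !mxE -big_split/=; apply: eq_bigr => l _.
  by rewrite /GRing.scale/= addrC (mulrC (Y t l j)).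
by apply/funext => s; rewrite mxE fct_sumE.
Qed.

Lemma mx_deriveMl m n p (C : 'M[R]_(m, n)) (Y : R -> 'M[R]_(n, p)) t E :
  mx_derive Y t E -> mx_derive (fun s => C *m Y s) t (C *m E).
Proof.
move=> YE; have := mx_deriveM (mx_derive_cst C t) YE.
by rewrite mul0mx add0r.
Qed.

Lemma mx_deriveMr m n p (X : R -> 'M[R]_(m, n)) (C : 'M[R]_(n, p)) t D :
  mx_derive X t D -> mx_derive (fun s => X s *m C) t (D *m C).
Proof.
move=> XD; have := mx_deriveM XD (mx_derive_cst C t).
by rewrite mulmx0 addr0.
Qed.

Lemma mx_deriveZ m n (f : R -> R) (C : 'M[R]_(m, n)) (t df : R) :
  is_derive t 1 f df -> mx_derive (fun s => f s *: C) t (df *: C).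
Proof.
move=> fd i j; rewrite mxE.
rewrite (_ : (fun s => _) = (C i j) *: f).
  by rewrite mulrC; exact: is_deriveZ.
by apply/funext => s; rewrite mxE mulrC.
Qed.

Lemma mx_derive_tr m n (X : R -> 'M[R]_(m, n)) t D :
  mx_derive X t D -> mx_derive (fun s => (X s)^T) t D^T.
Proof.
move=> XD i j; rewrite mxE.
by rewrite (_ : (fun s => _) = (fun s => X s j i)) //; apply/funext => s; rewrite mxE.
Qed.

Lemma mx_derive0_cst m n (X : R -> 'M[R]_(m, n)) s t :
  (forall u, mx_derive X u 0) -> X s = X t.
Proof.
move=> X0; apply/matrixP => i j.
apply: (@is_derive_0_is_cst _ (fun u => X u i j)) => u.
by have := X0 u i j; rewrite mxE.
Qed.

Lemma mx_derive_continuous n (X dX : R -> 'M[R]_n) :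
  (forall t, mx_derive X t (dX t)) -> continuous_mx X.
Proof.
by move=> Xd i j; apply: (@is_derive_continuous _ _ (fun t => dX t i j)) => t; exact: Xd.
Qed.

Lemma continuous_mxM n (X Y : R -> 'M[R]_n) :
  continuous_mx X -> continuous_mx Y -> continuous_mx (fun t => X t *m Y t).
Proof.
move=> Xc Yc i j.
rewrite (_ : (fun t => _) = fun t => \sum_(l < n) X t i l * Y t l j).
  apply: continuous_big => [|l _ t]; first exact: add_continuous.
  by apply: cvgM; [exact: Xc|exact: Yc].
by apply/funext => t; rewrite mxE.
Qed.

Lemma continuous_det n (X : R -> 'M[R]_n) :
  continuous_mx X -> continuous (fun t => \det (X t)).
Proof.
move=> Xc; rewrite /determinant; apply: continuous_big => [|s _ t]; first exact: add_continuous.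
apply: cvgM; first exact: cvg_cst.
by apply: continuous_big => [|i _]; [exact: mul_continuous|exact: Xc].
Qed.

Lemma continuous_invmx n (X : R -> 'M[R]_n) :
    (forall t, X t \in unitmx) -> continuous_mx X ->
  continuous_mx (fun t => invmx (X t)).
Proof.
move=> uX Xc i j.
(* Cramer's formula reduces continuity of the inverse to that of determinants. *)
rewrite (_ : (fun t => _) = fun t => (\det (X t))^-1 * cofactor (X t) j i).
  move=> t; apply: cvgM.
    apply: cvgV; first by rewrite -unitfE -unitmxE.
    exact: continuous_det.
  apply: cvgM; first exact: cvg_cst.
  apply: (@continuous_det _ (fun s => row' j (col' i (X s)))) => a b.
  rewrite (_ : (fun s => _) = fun s => X s (lift j a) (lift i b)); first exact: Xc.
  by apply/funext => s; rewrite !mxE.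
by apply/funext => t; rewrite /invmx uX !mxE.
Qed.

Lemma mx_antiderivative n (F : R -> 'M[R]_n) : continuous_mx F ->
  exists2 G : R -> 'M[R]_n, (forall t, mx_derive G t (F t)) & G 0 = 0.
Proof.
move=> Fc.
have H (ij : 'I_n * 'I_n) : exists g : R -> R,
    (forall t : R, is_derive t 1 g (F t ij.1 ij.2)) /\ g 0 = 0.
  by have [g gd g0] := continuous_antiderivative (Fc ij.1 ij.2); exists g.
have [g Hg] := choice H.
exists (fun t => \matrix_(i, j) g (i, j) t).
  move=> t i j; rewrite (_ : (fun s => _) = g (i, j)); first exact: (Hg (i, j)).1.
  by apply/funext => s; rewrite mxE.
by apply/matrixP => i j; rewrite !mxE (Hg (i, j)).2.
Qed.

Lemma continuous_bounded_segment (f : R -> R) (K : R) : continuous f ->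
  exists2 a : R, 0 <= a & forall t, `|t| <= K -> `|f t| <= a.
Proof.
move=> fc; have [K0|K0] := ltP K 0.
  by exists 0 => // t tK; have := le_lt_trans (le_trans (normr_ge0 t) tK) K0; rewrite ltxx.
have nc : continuous (fun t => `|f t|) by move=> t; apply: cvg_norm; exact: fc.
have KK : - K <= K by rewrite (le_trans _ K0)// oppr_le0.
have [c _ Hc] := EVT_max KK (within_continuousT nc).
exists `|f c| => // t; rewrite ler_norml => tK.
by apply: Hc; rewrite in_itv.
Qed.

Lemma continuous_mx_bounded_segment n (A : R -> 'M[R]_n) (K : R) : continuous_mx A ->
  exists2 a : R, 0 <= a & forall t i j, `|t| <= K -> `|A t i j| <= a.
Proof.
move=> Ac.
have H (ij : 'I_n * 'I_n) : exists a : R,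
    0 <= a /\ forall t, `|t| <= K -> `|A t ij.1 ij.2| <= a.
  by have [a a0 Ha] := continuous_bounded_segment K (Ac ij.1 ij.2); exists a.
have [a Ha] := choice H.
exists (\sum_ij a ij); first by apply: sumr_ge0 => ij _; exact: (Ha ij).1.
move=> t i j tK; rewrite (bigD1 (i, j))//=.
apply: le_trans ((Ha (i, j)).2 t tK) _; rewrite lerDl.
by apply: sumr_ge0 => ij _; exact: (Ha ij).1.
Qed.

Definition mx_series n (X : nat -> R -> 'M[R]_n) (t : R) : 'M[R]_n :=
  \matrix_(i, j) limn (fun N : nat => \sum_(k < N) X k t i j).

Section Picard.
Variables (n : nat) (A : R -> 'M[R]_n) (X : nat -> R -> 'M[R]_n).
Hypothesis Ac : continuous_mx A.
Hypothesis X0 : forall t, X 0%N t = 1%:M.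
Hypothesis XS : forall k t, mx_derive (X k.+1) t (A t *m X k t).
Hypothesis XS0 : forall k, X k.+1 0 = 0.

(** If [a] bounds the entries of [A] on the segment, [c = n a] absorbs the [n] terms of an entry of
    a product; each integration then gains a factor 1/2 by [exp_weight_contraction]. *)
Lemma picard_bound (K : R) : exists2 c : R, 0 <= c & forall k t i j, `|t| <= K ->
  `|X k t i j| <= 2^-1 ^+ k * expR (2 * c * `|t|) /\
  `|(A t *m X k t) i j| <= c * 2^-1 ^+ k * expR (2 * c * `|t|).
Proof.
have [a a0 Ha] := continuous_mx_bounded_segment K Ac.
exists (n%:R * a); first by rewrite mulr_ge0.
set c := n%:R * a; have c0 : 0 <= c by rewrite mulr_ge0.
have prod k t : `|t| <= K ->
    (forall i j, `|X k t i j| <= 2^-1 ^+ k * expR (2 * c * `|t|)) ->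
    forall i j, `|(A t *m X k t) i j| <= c * 2^-1 ^+ k * expR (2 * c * `|t|).
  move=> tK H i j; rewrite mxE.
  apply: le_trans (ler_norm_sum _ _ _) _.
  rewrite -mulrA {1}/c -mulrA -[n in n%:R]card_ord mulr_natl -sumr_const.
  by apply: ler_sum => l _; rewrite normrM ler_pM// Ha.
have Xb k : forall t i j, `|t| <= K -> `|X k t i j| <= 2^-1 ^+ k * expR (2 * c * `|t|).
  elim: k => [|k IH] t i j tK.
    rewrite X0 mxE expr0 mul1r.
    apply: (@le_trans _ _ 1).
      by case: (i == j); rewrite ?normr1// mulr0n normr0 ler01.
    by rewrite -expR0 ler_expR !mulr_ge0.
  rewrite exprSr.
  apply: (@exp_weight_contraction _ (fun s => X k.+1 s i j)
    (fun s => (A s *m X k s) i j) K) => //.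
  - by move=> s; exact: XS.
  - by rewrite XS0 mxE.
  - by move=> s sK; apply: prod => // i' j'; exact: IH.
by move=> k t i j tK; split; [exact: Xb|apply: prod => // i' j'; exact: Xb].
Qed.

Lemma picard_terms_dominated (K : R) : exists2 C : R, 0 <= C &
  forall k t i j, `|t| <= K ->
  `|X k t i j| <= C * 2^-1 ^+ k /\ `|(A t *m X k t) i j| <= C * 2^-1 ^+ k.+1.
Proof.
have [c c0 Hc] := picard_bound K.
have h0 k : 0 <= 2^-1 ^+ k :> R by rewrite exprn_ge0.
have eE (t : R) : `|t| <= K -> expR (2 * c * `|t|) <= expR (2 * c * K).
  by move=> tK; rewrite ler_expR ler_wpM2l// mulr_ge0.
have e0 := expR_ge0 (2 * c * K).
(* The weight is at most its value at [K]. The summand [1] serves the terms, and [2 * c] the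
   products with [A], whose power of 1/2 is one higher. *)
exists ((1 + 2 * c) * expR (2 * c * K)).
  by rewrite mulr_ge0// addr_ge0// mulr_ge0.
move=> k t i j tK; have [H1 H2] := Hc k t i j tK; split.
  apply: le_trans H1 _; rewrite mulrC ler_wpM2r//.
  by rewrite (le_trans (eE _ tK))// ler_peMl// lerDl mulr_ge0.
apply: le_trans H2 _; rewrite exprS.
rewrite (_ : _ * (2^-1 * _) = (2^-1 + c) * 2^-1 ^+ k * expR (2 * c * K)); last by field.
apply: ler_pM; rewrite ?mulr_ge0 ?expR_ge0 ?eE//.
by rewrite ler_wpM2r// lerDr invr_ge0.
Qed.

Lemma picard_cvg t i j : cvgn (fun N : nat => \sum_(k < N) X k t i j).
Proof.
have [C C0 HC] := picard_terms_dominated `|t|.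
by have [] := geometric_dominated_series (fun k => (HC k t i j (lexx _)).1).
Qed.

Lemma picard_series_at0 : mx_series X 0 = 1%:M.
Proof.
apply/matrixP => i j; rewrite mxE; apply: cvg_lim => //.
rewrite -cvg_shiftS/= (_ : (fun N => _) = fun=> (1%:M : 'M[R]_n) i j); first exact: cvg_cst.
apply/funext => N; rewrite big_ord_recl X0 big1 ?addr0// => k _.
by rewrite XS0 mxE.
Qed.

Lemma picard_series_derive t : mx_derive (mx_series X) t (A t *m mx_series X t).
Proof.
move=> i j.
(* The derivative series is shifted by one: term 0 is constant, and each later term differentiates
   to [A] times its predecessor. *)
pose du k s := if k is k'.+1 then (A s *m X k' s) i j else 0.
have dX k (s : R) : is_derive s 1 (fun u => X k u i j) (du k s).
  case: k => [|k]; last exact: XS.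
  rewrite (_ : (fun u => _) = cst ((1%:M : 'M[R]_n) i j)); first exact: is_derive_cst.
  by apply/funext => u; rewrite X0.
have bnd (K : R) : exists C : R, forall k s, `|s| <= K ->
    `|X k s i j| <= C * 2^-1 ^+ k /\ `|du k s| <= C * 2^-1 ^+ k.
  have [C C0 HC] := picard_terms_dominated K; exists C => k s sK; split.
    by have [] := HC k s i j sK.
  case: k => [|k]; first by rewrite normr0 mulr_ge0// exprn_ge0.
  by have [] := HC k s i j sK.
have := is_derive_series dX bnd t.
rewrite (_ : (fun s => limn _) = fun s => mx_series X s i j); last first.
  by apply/funext => s; rewrite mxE.
move/is_derive_eq; apply; apply: cvg_lim => //.
rewrite -cvg_shiftS/= (_ : (fun N => _) =
    fun N => \sum_(l < n) A t i l * \sum_(k < N) X k t l j).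
  rewrite mxE; apply: cvg_big => [|l _]; first exact: add_continuous.
  apply: cvgM; first exact: cvg_cst.
  by rewrite mxE; exact: picard_cvg.
apply/funext => N; rewrite big_ord_recl add0r.
under eq_bigr do rewrite /= mxE.
by rewrite exchange_big; apply: eq_bigr => l _; rewrite mulr_sumr.
Qed.

End Picard.

Lemma linear_ode_exists n (A : R -> 'M[R]_n) : continuous_mx A ->
  exists2 Phi : R -> 'M[R]_n,
    (forall t, mx_derive Phi t (A t *m Phi t)) & Phi 0 = 1%:M.
Proof.
move=> Ac.
(* Antiderivation becomes a total function, with default 0 on discontinuous [F], so that the
   iterates [X] can be defined before their continuity is proved. *)
have H (F : R -> 'M[R]_n) : exists G : R -> 'M[R]_n,
    continuous_mx F -> (forall t, mx_derive G t (F t)) /\ G 0 = 0.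
  have [Fc|nFc] := pselect (continuous_mx F); last by exists (fun=> 0).
  by have [G Gd G0] := mx_antiderivative Fc; exists G.
have [I HI] := choice H.
pose X := fix X k := if k is k'.+1 then I (fun t => A t *m X k' t) else fun=> 1%:M.
have Xc k : continuous_mx (X k).
  elim: k => [|k IH] /=; first by move=> i j t; exact: cvg_cst.
  exact: mx_derive_continuous (HI _ (continuous_mxM Ac IH)).1.
have XS k t : mx_derive (X k.+1) t (A t *m X k t).
  exact: (HI _ (continuous_mxM Ac (Xc k))).1.
have XS0 k : X k.+1 0 = 0 by exact: (HI _ (continuous_mxM Ac (Xc k))).2.
exists (mx_series X); first by move=> t; exact: picard_series_derive.
exact: picard_series_at0 XS0.
Qed.

End MatrixCalculus.

(** * Linear systems, the matrix exponential and the logarithm along a path *)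

Section LinearODE.
Variable R : realType.

(** [Psi] is the transpose of a solution of the adjoint system [Y' = - A^T Y], so [Psi X] is
    constant for every solution [X]. This common left inverse yields uniqueness, and invertibility
    of the solution starting at 1. *)
Lemma linear_ode_inverse n (A : R -> 'M[R]_n) : continuous_mx A ->
  exists2 Psi : R -> 'M[R]_n, (forall t, Psi t \in unitmx) &
    forall X : R -> 'M[R]_n, (forall t, mx_derive X t (A t *m X t)) ->
    forall t, Psi t *m X t = X 0.
Proof.
move=> Ac.
have Ac' : continuous_mx (fun t => - (A t)^T).
  move=> i j; rewrite (_ : (fun t => _) = fun t => - A t j i).
    by move=> t; apply: cvgN; exact: Ac.
  by apply/funext => t; rewrite !mxE.
have [Y Yd Y0] := linear_ode_exists Ac'.
pose Psi t := (Y t)^T.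
have dPsi t : mx_derive Psi t (- (Psi t *m A t)).
  apply: mx_derive_eq (mx_derive_tr (Yd t)) _.
  by rewrite trmx_mul linearN/= trmxK mulmxN.
have inv (X : R -> 'M[R]_n) : (forall t, mx_derive X t (A t *m X t)) -> forall t, Psi t *m X t = X 0.
  move=> Xd t.
  rewrite (@mx_derive0_cst _ _ _ (fun s => Psi s *m X s) t 0).
    by rewrite /Psi Y0 trmx1 mul1mx.
  move=> u; apply: mx_derive_eq (mx_deriveM (dPsi u) (Xd u)) _.
  by rewrite mulNmx mulmxA addNr.
exists Psi => // t; have [Phi Phid Phi0] := linear_ode_exists Ac.
by have := inv _ Phid t; rewrite Phi0 => /mulmx1_unit[].
Qed.

Lemma linear_ode_unique n (A X Y : R -> 'M[R]_n) : continuous_mx A ->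
    (forall t, mx_derive X t (A t *m X t)) ->
    (forall t, mx_derive Y t (A t *m Y t)) -> X 0 = Y 0 ->
  forall t, X t = Y t.
Proof.
move=> Ac Xd Yd e t; have [Psi uPsi inv] := linear_ode_inverse Ac.
by apply: (can_inj (mulKmx (uPsi t))); rewrite !inv.
Qed.

Lemma linear_ode_eq_mulr n (A X Y : R -> 'M[R]_n) : continuous_mx A ->
    (forall t, mx_derive X t (A t *m X t)) ->
    (forall t, mx_derive Y t (A t *m Y t)) -> X 0 \in unitmx ->
  forall t, Y t = X t *m (invmx (X 0) *m Y 0).
Proof.
move=> Ac Xd Yd uX.
apply: (@linear_ode_unique _ A Y (fun t => X t *m _)) => // [t|].
  by apply: mx_derive_eq (mx_deriveMr _ (Xd t)) _; rewrite mulmxA.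
by rewrite mulmxA mulmxV// mul1mx.
Qed.

Lemma mx_derive_exp n (L : R -> 'M[R]_n) (t : R) (D : 'M[R]_n) k :
    mx_derive L t D -> D *m L t = L t *m D ->
  mx_derive (fun s => L s ^+ k.+1) t (k.+1%:R *: (D *m L t ^+ k)).
Proof.
move=> Ld c; elim: k => [|k IH]; first by rewrite expr0 mulmx1 scale1r.
rewrite (_ : (fun s => _) = fun s => L s *m L s ^+ k.+1); last first.
  by apply/funext => s; rewrite mulmx_expr_l.
apply: mx_derive_eq (mx_deriveM Ld IH) _.
rewrite -scalemxAr (mulmxA (L t)) -c -(mulmxA D) mulmx_expr_l.
by rewrite -[X in X + _]scale1r -scalerDl -[k.+2%:R]natr1 addrC.
Qed.

(** As [G = L'] commutes with [L], the terms [L^k / k!] obey the Picard recursion for [G]. The case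
    [L t = t B] gives the usual exponential; the general case serves the logarithm. *)
Lemma mexp_path_derive n (L G : R -> 'M[R]_n) :
    continuous_mx G -> (forall t, mx_derive L t (G t)) -> L 0 = 0 ->
    (forall t, G t *m L t = L t *m G t) ->
  mexp (L 0) = 1%:M /\ forall t, mx_derive (fun s => mexp (L s)) t (G t *m mexp (L t)).
Proof.
move=> Gc Ld L0 c.
pose X k t := (k`!)%:R^-1 *: L t ^+ k.
have e t : mexp (L t) = mx_series X t.
  apply/matrixP => i j; rewrite !mxE; congr (limn _); apply/funext => N.
  by rewrite summxE.
have X0 t : X 0%N t = 1%:M by rewrite /X fact0 invr1 scale1r expr0.
have XS k t : mx_derive (X k.+1) t (G t *m X k t).
  rewrite /X -scalemxAr.
  have d := mx_derive_exp k (Ld t) (c t).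
  have d' := mx_deriveMl ((k.+1`!)%:R^-1%:M) d.
  rewrite (_ : (fun s => _) = fun s => (k.+1`!)%:R^-1%:M *m L s ^+ k.+1); last first.
    by apply/funext => s; rewrite mul_scalar_mx.
  apply: mx_derive_eq d' _; rewrite mul_scalar_mx scalerA factS natrM invfM.
  by rewrite mulrAC mulVf ?mul1r// pnatr_eq0.
have XS0 k : X k.+1 0 = 0 by rewrite /X L0 expr0n scaler0.
split; first by rewrite e; exact: picard_series_at0 X0 XS0.
move=> t; rewrite e (_ : (fun s => _) = mx_series X); last exact/funext.
exact: picard_series_derive.
Qed.

Lemma continuous_mx_cst n (B : 'M[R]_n) : continuous_mx (fun=> B).
Proof. by move=> i j t; exact: cvg_cst. Qed.

Lemma mx_derive_scaler n (B : 'M[R]_n) (t : R) : mx_derive (fun s => s *: B) t B.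
Proof. by have := mx_deriveZ B (is_derive_id t 1); rewrite scale1r. Qed.

Lemma mexp_spec n (B : 'M[R]_n) : mexp (0 *: B) = 1%:M /\
  forall t, mx_derive (fun s => mexp (s *: B)) t (B *m mexp (t *: B)).
Proof.
apply: (@mexp_path_derive _ (fun t => t *: B) (fun=> B)).
- exact: continuous_mx_cst.
- exact: mx_derive_scaler.
- by rewrite scale0r.
- by move=> t; rewrite -scalemxAl -scalemxAr.
Qed.

Lemma mexp0 n : mexp (0 : 'M[R]_n) = 1%:M.
Proof. by rewrite -(scale0r (0 : 'M[R]_n)); exact: (mexp_spec _).1. Qed.

Lemma mexp_scale_derive n (B : 'M[R]_n) t :
  mx_derive (fun s => mexp (s *: B)) t (B *m mexp (t *: B)).
Proof. exact: (mexp_spec B).2. Qed.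

(** Several identities below follow from this by exhibiting the other side as a solution of the same
    initial value problem, mostly evaluated at [t = 1]. *)
Lemma mexp_unique n (B : 'M[R]_n) (X : R -> 'M[R]_n) :
    (forall t, mx_derive X t (B *m X t)) -> X 0 = 1%:M ->
  forall t, X t = mexp (t *: B).
Proof.
move=> Xd X0; apply: (@linear_ode_unique _ (fun=> B) X (fun t => mexp (t *: B))) => //.
- exact: continuous_mx_cst.
- exact: mexp_scale_derive.
- by rewrite scale0r mexp0.
Qed.

Lemma mexp_comm n (K B : 'M[R]_n) t :
  K *m B = B *m K -> K *m mexp (t *: B) = mexp (t *: B) *m K.
Proof.
move=> KB; move: t; apply: (@linear_ode_unique _ (fun=> B) (fun t => K *m mexp (t *: B))
  (fun t => mexp (t *: B) *m K)).
- exact: continuous_mx_cst.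
- move=> t; apply: mx_derive_eq (mx_deriveMl K (mexp_scale_derive B t)) _.
  by rewrite !mulmxA KB.
- move=> t; apply: mx_derive_eq (mx_deriveMr K (mexp_scale_derive B t)) _.
  by rewrite mulmxA.
- by rewrite scale0r mexp0 mul1mx mulmx1.
Qed.

Lemma mexpD n (A B : 'M[R]_n) : A *m B = B *m A ->
  mexp (A + B) = mexp A *m mexp B.
Proof.
move=> AB; rewrite -[A + B]scale1r -[A in RHS]scale1r -[B in RHS]scale1r.
symmetry; apply: (@mexp_unique _ (A + B) (fun t => mexp (t *: A) *m mexp (t *: B))).
  move=> t; apply: mx_derive_eq
    (mx_deriveM (mexp_scale_derive A t) (mexp_scale_derive B t)) _.
  by rewrite !mulmxA -(mexp_comm t (esym AB)) mulmxDl mulmxDl.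
by rewrite !scale0r !mexp0 mulmx1.
Qed.

Lemma mexp_scaleD n (s t : R) (B : 'M[R]_n) :
  mexp ((s + t) *: B) = mexp (s *: B) *m mexp (t *: B).
Proof. by rewrite scalerDl mexpD// -!scalemxAl -!scalemxAr !scalerA mulrC. Qed.

Lemma mexp_sim n m (P : 'M[R]_(n, m)) (Q : 'M[R]_(m, n)) (B : 'M[R]_m) :
  P *m Q = 1%:M -> Q *m P = 1%:M -> mexp (P *m B *m Q) = P *m mexp B *m Q.
Proof.
move=> PQ QP; rewrite -[P *m B *m Q]scale1r -[B in RHS]scale1r.
symmetry; apply: (@mexp_unique _ _ (fun t => P *m mexp (t *: B) *m Q)) => [t|].
  apply: mx_derive_eq (mx_deriveMr Q (mx_deriveMl P (mexp_scale_derive B t))) _.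
  by rewrite !mulmxA -(mulmxA _ Q P) QP mulmx1.
by rewrite scale0r mexp0 mulmx1.
Qed.

Lemma mx_derive_block n m (X : R -> 'M[R]_n) (Y : R -> 'M[R]_m) t D E :
    mx_derive X t D -> mx_derive Y t E ->
  mx_derive (fun s => block_mx (X s) 0 0 (Y s)) t (block_mx D 0 0 E).
Proof.
move=> XD YE i j.
rewrite -(splitK i) -(splitK j); case: (fintype.split i) => i'; case: (fintype.split j) => j' /=.
- by under eq_fun do rewrite block_mxEul; rewrite block_mxEul; exact: XD.
- by under eq_fun do rewrite block_mxEur mxE; rewrite block_mxEur mxE; exact: is_derive_cst.
- by under eq_fun do rewrite block_mxEdl mxE; rewrite block_mxEdl mxE; exact: is_derive_cst.
- by under eq_fun do rewrite block_mxEdr; rewrite block_mxEdr; exact: YE.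
Qed.

Lemma mexp_block n m (A : 'M[R]_n) (B : 'M[R]_m) :
  mexp (block_mx A 0 0 B) = block_mx (mexp A) 0 0 (mexp B).
Proof.
rewrite -[block_mx A _ _ _]scale1r -[A in RHS]scale1r -[B in RHS]scale1r.
symmetry; apply: (@mexp_unique _ _
  (fun t => block_mx (mexp (t *: A)) 0 0 (mexp (t *: B)))) => [t|].
  apply: mx_derive_eq (mx_derive_block (mexp_scale_derive A t) (mexp_scale_derive B t)) _.
  by rewrite mulmx_block !(mulmx0, mul0mx, addr0, add0r).
by rewrite !scale0r !mexp0 -scalar_mx_block.
Qed.

Lemma mexp_pi n (J : 'M[R]_n) : J *m J = - 1%:M -> mexp (pi *: J) = - 1%:M.
Proof.
move=> JJ.
(* Euler's formula, with [J] in the role of the imaginary unit. *)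
rewrite -(@mexp_unique _ J (fun t => cos t *: 1%:M + sin t *: J)).
- by rewrite cospi sinpi scale0r addr0 scaleN1r.
- move=> t; apply: mx_derive_eq
    (mx_deriveD (mx_deriveZ _ (is_derive_cos t)) (mx_deriveZ _ (is_derive_sin t))) _.
  by rewrite mulmxDr -!scalemxAr JJ mulmx1 scalerN scaleNr addrC.
- by rewrite cos0 sin0 scale0r addr0 scale1r.
Qed.

(* The segment from 1 to M, run through as cos^2 + sin^2 M so that the path is
   defined on all of R, stays invertible; the logarithm is the antiderivative of
   its logarithmic derivative. *)
Lemma mexp_log n (M : 'M[R]_n) : (forall a : R, a <= 0 -> M - a%:M \in unitmx) ->
  exists2 L : 'M[R]_n, mexp L = M & forall K, K *m M = M *m K -> K *m L = L *m K.
Proof.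
move=> uM.
pose X (t : R) : 'M[R]_n := (cos t ^+ 2)%:M + sin t ^+ 2 *: M.
have uX t : X t \in unitmx.
  have [s0|s0] := eqVneq (sin t) 0.
    have := cos2Dsin2 t; rewrite /X s0 expr0n addr0 => ->.
    by rewrite scale0r addr0 unitmx1.
  (* [X t] is a positive multiple of [M - a] with [a = - cos^2 / sin^2 <= 0], the range covered by
     [uM]. *)
  have -> : X t = sin t ^+ 2 *: (M - (- (cos t ^+ 2 / sin t ^+ 2))%:M).
    rewrite scalerBr scale_scalar_mx mulrN mulrC divfK ?sqrf_eq0//.
    by rewrite /X addrC raddfN/= opprK.
  rewrite unitmxZ ?unitfE ?sqrf_eq0//; apply: uM.
  by rewrite oppr_le0 divr_ge0// sqr_ge0.
pose dX (t : R) : 'M[R]_n := (2 * sin t * cos t) *: (M - 1%:M).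
have dXP t : mx_derive X t (dX t).
  have dc : is_derive t 1 (fun s : R => cos s ^+ 2) (- (2 * sin t * cos t)).
    rewrite (_ : (fun s => _) = (@cos R) * (@cos R)); last by apply/funext => s; rewrite expr2.
    apply: is_derive_eq (is_deriveM (is_derive_cos t) (is_derive_cos t)) _.
    by rewrite /GRing.scale/=; ring.
  have ds : is_derive t 1 (fun s : R => sin s ^+ 2) (2 * sin t * cos t).
    rewrite (_ : (fun s => _) = (@sin R) * (@sin R)); last by apply/funext => s; rewrite expr2.
    apply: is_derive_eq (is_deriveM (is_derive_sin t) (is_derive_sin t)) _.
    by rewrite /GRing.scale/=; ring.
  have := mx_deriveD (mx_deriveZ (1%:M : 'M[R]_n) dc) (mx_deriveZ M ds).
  rewrite (_ : (fun s => _ + _) = X); last first.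
    by apply/funext => s; rewrite /X scalemx1.
  move/mx_derive_eq; apply.
  by rewrite /dX scalerBr scaleNr addrC.
pose G t := dX t *m invmx (X t).
have commX K t : K *m M = M *m K -> K *m X t = X t *m K.
  by move=> KM; rewrite /X mulmxDr mulmxDl scalar_mxC -scalemxAl -scalemxAr KM.
have commXV K t : K *m M = M *m K -> K *m invmx (X t) = invmx (X t) *m K.
  move=> /(commX K t) KX.
  by rewrite -[LHS](mulKmx (uX t)) (mulmxA (X t)) -KX -(mulmxA K) mulmxV// mulmx1.
have commG K t : K *m M = M *m K -> K *m G t = G t *m K.
  move=> KM; rewrite /G mulmxA -(mulmxA (dX t)) -(commXV _ _ KM) (mulmxA (dX t)).
  congr (_ *m _); rewrite /dX -scalemxAl -scalemxAr mulmxBr mulmxBl KM.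
  by rewrite mul1mx mulmx1.
have Xc : continuous_mx X := mx_derive_continuous dXP.
have Gc : continuous_mx G.
  apply: continuous_mxM; last exact: continuous_invmx.
  move=> i j; rewrite (_ : (fun t => _) = fun t => 2 * sin t * cos t * (M - 1%:M) i j).
    move=> t; apply: cvgM; last exact: cvg_cst.
    apply: cvgM; last exact: continuous_cos.
    by apply: cvgM; [exact: cvg_cst|exact: continuous_sin].
  by apply/funext => t; rewrite mxE.
have [L Ld L0] := mx_antiderivative Gc.
(* The commutator of [K] and [L] starts at 0 and has zero derivative, since [K] commutes with
   [G]. *)
have commL K t : K *m M = M *m K -> K *m L t = L t *m K.
  move=> KM; apply/eqP; rewrite -subr_eq0; apply/eqP.
  rewrite (@mx_derive0_cst _ _ _ (fun s => K *m L s - L s *m K) t 0).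
    by rewrite L0 mulmx0 mul0mx subrr.
  move=> u; rewrite (_ : (fun s => _) = fun s => K *m L s + L s *m (- K)); last first.
    by apply/funext => s; rewrite mulmxN.
  apply: mx_derive_eq (mx_deriveD (mx_deriveMl _ (Ld u)) (mx_deriveMr _ (Ld u))) _.
  by rewrite mulmxN commG// subrr.
(* [M] commutes with itself, hence with [L t]; then [L t] commutes with [M], hence with [G t]. *)
have GL t : G t *m L t = L t *m G t.
  by apply/esym/commG/esym/commL.
have [E0 Ed] := mexp_path_derive Gc Ld L0 GL.
have e t : mexp (L t) = X t.
  move: t; apply: (@linear_ode_unique _ G (fun t => mexp (L t)) X) => //.
    by move=> t; apply: mx_derive_eq (dXP t) _; rewrite /G mulmxKV.
  by rewrite E0 /X cos0 sin0 expr1n expr0n scale0r addr0.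
(* At [pi / 2] the path has reached [M]. *)
exists (L (pi / 2)); last by move=> K; exact: commL.
by rewrite e /X cos_pihalf sin_pihalf expr1n expr0n scale1r raddf0 add0r.
Qed.

End LinearODE.

(** * Existence of Jordan forms and the ranks they determine *)

Section JordanForm.

Lemma mxsim_empty (F : fieldType) n1 n2 (A : 'M[F]_n1) (B : 'M[F]_n2) :
  n1 = 0%N -> n2 = 0%N -> mxsim A B.
Proof.
move=> e1 e2; subst n1 n2; rewrite (flatmx0 A) (flatmx0 B).
exact: mxsim_refl.
Qed.

Lemma mxrank_mxdiag_shift_exp (F : fieldType) m (p : 'I_m -> nat)
    (B : forall i, 'M[F]_(p i)) (a : F) k :
  \rank ((\mxdiag_i B i - a%:M) ^+ k) = (\sum_i \rank ((B i - a%:M) ^+ k))%N.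
Proof.
elim: m p B => [|m IH] p B.
  rewrite [RHS]big_ord0; apply/eqP; rewrite -leqn0.
  by apply: leq_trans (rank_leq_row _) _; rewrite big_ord0.
rewrite mxdiag_recl (mxrank_shift_exp_sim _ _ (mxsim_cast _ _)).
by rewrite mxrank_block_shift_exp IH big_ord_recl.
Qed.

(** Strong induction on the dimension: the characteristic polynomial has a root, and [eigen_split]
    detaches a block for it. *)
Lemma mxsim_jordan (F : closedFieldType) n (M : 'M[F]_n) :
  exists (m : nat) (lam : 'I_m -> F) (p : 'I_m -> nat),
    (forall i, (0 < p i)%N) /\
    mxsim M (\mxdiag_(i < m) jordan_block (lam i) (p i)).
Proof.
have [N] := ubnP n; elim: N n M => // N IH n M; rewrite ltnS => nN.
have [n0|n_gt0] := posnP n.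
  exists 0%N, (fun=> 0), (fun=> 0%N); split; first by case.
  by apply: mxsim_empty; rewrite ?big_ord0.
have /closed_rootP[l] : size (char_poly M) != 1%N.
  by rewrite size_char_poly eqSS -lt0n.
rewrite -eigenvalue_root_char /eigenvalue /eigenspace kermx_eq0 row_free_unit.
move=> /eigen_split[k [n' [M' MM']]].
have en := mxsim_dim MM'.
have [|m [lam [p [p0 Hs]]]] := IH n' M'; first by lia.
pose lam' (i : 'I_m.+1) := oapp lam l (unlift ord0 i).
pose p' (i : 'I_m.+1) := oapp p k.+1 (unlift ord0 i).
exists m.+1, lam', p'; split.
  by move=> i; rewrite /p'; case: unliftP => [j|] /=.
apply: mxsim_trans MM' _; apply: mxsim_sym.
rewrite mxdiag_recl; apply: mxsim_trans (mxsim_cast _ _) _.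
apply: mxsim_block.
  have [e1 e2] : lam' ord0 = l /\ p' ord0 = k.+1 by rewrite /lam' /p' unlift_none.
  by rewrite e1; case: _ / (esym e2); exact: mxsim_refl.
apply: mxsim_sym; apply: mxsim_trans Hs _.
(* The remaining parameters equal [lam] and [p] only by extensionality; generalising them lets these
   equalities rewrite inside the dependent type of the block matrix. *)
suff H (lam1 : 'I_m -> F) (p1 : 'I_m -> nat) : lam1 = lam -> p1 = p ->
    mxsim (\mxdiag_i jordan_block (lam i) (p i)) (\mxdiag_i jordan_block (lam1 i) (p1 i)).
  by apply: (H (lam' \o lift ord0) (p' \o lift ord0)); apply/funext => i;
    rewrite /= /lam' /p' liftK.
by move=> -> ->; exact: mxsim_refl.
Qed.

(** [A_index_zero] quantifies over all decompositions; existence of one is what lets rank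
    information be drawn from it. *)
Lemma jordan_decomp_exists (F : closedFieldType) n (M : 'M[F]_n) :
  exists (m : nat) (lam : 'I_m -> F) (p : 'I_m -> nat), Defs.jordan_decomp M lam p.
Proof.
have [m [lam [p [p0 /[dup] /mxsim_dim e Hs]]]] := mxsim_jordan M.
exists m, lam, p; split=> //; exists (esym e); move: (esym e) Hs => {}e.
case: n / e M => M [P [Q [PQ QP ->]]]; exists Q; have [uQ uP] := mulmx1_unit QP.
split=> //; rewrite castmx_id; congr (_ *m _ *m _).
by rewrite -[LHS]mul1mx -(mulVmx uQ) -mulmxA QP mulmx1.
Qed.

Lemma jordan_decomp_sim (F : fieldType) n (M : 'M[F]_n) m (lam : 'I_m -> F)
    (p : 'I_m -> nat) : Defs.jordan_decomp M lam p ->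
  mxsim M (\mxdiag_(i < m) jordan_block (lam i) (p i)).
Proof.
move=> [_ [e [P [uP ->]]]].
apply: mxsim_trans (mxsim_cast e _).
by exists (invmx P), P; rewrite mulVmx ?mulmxV.
Qed.

Lemma jordan_decomp_rank (F : fieldType) n (M : 'M[F]_n) m (lam : 'I_m -> F)
    (p : 'I_m -> nat) (a : F) k : Defs.jordan_decomp M lam p ->
  \rank ((M - a%:M) ^+ k) =
  (\sum_(i < m) if lam i == a then p i - k else p i)%N.
Proof.
move=> /jordan_decomp_sim /mxrank_shift_exp_sim ->.
rewrite mxrank_mxdiag_shift_exp; apply: eq_bigr => i _.
by rewrite jordan_block_shift rank_jordan_block_exp subr_eq0.
Qed.

End JordanForm.

(** * Index zero as a parity condition on ranks, and its validity for squares *)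

Section NegativeBlocks.
Variable R : realType.

(** The rank drop from [k] to [k.+1] counts the blocks for [a] of size above [k], so this expresses
    index zero over the reals without choosing a Jordan form. *)
Definition even_neg_ranks n (M : 'M[R]_n) : Prop := forall (a : R) k, a < 0 ->
  odd (\rank ((M - a%:M) ^+ k)) = odd (\rank ((M - a%:M) ^+ k.+1)).

Lemma map_shift_exp n (M : 'M[R]_n) (a : R) k :
  (map_mx (fun x : R => x%:C%C) M - (a%:C%C)%:M) ^+ k =
  map_mx (real_complex R) ((M - a%:M) ^+ k).
Proof.
rewrite -[X in X - _]/(map_mx (real_complex R) M) -map_scalar_mx -map_mxB.
elim: k => [|k IH]; first by rewrite !expr0 map_mx1.
by rewrite !exprS IH -!mulmxE map_mxM.
Qed.

Section Counting.
Variables (n m : nat) (M : 'M[R]_n) (lam : 'I_m -> R[i]) (p : 'I_m -> nat).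
Hypothesis MJ : Defs.jordan_decomp (map_mx (fun x : R => x%:C%C) M) lam p.

Let cnt_gt (a : R) (k : nat) := (\sum_(i < m) ((lam i == a%:C%C) && (k < p i)))%N.
Let cnt_eq (a : R) (q : nat) := (\sum_(i < m) ((lam i == a%:C%C) && (p i == q)))%N.

Lemma rank_shift_cnt (a : R) k :
  \rank ((M - a%:M) ^+ k) = (\rank ((M - a%:M) ^+ k.+1) + cnt_gt a k)%N.
Proof.
rewrite -!(mxrank_map (real_complex R)) -!map_shift_exp !(jordan_decomp_rank _ _ MJ).
rewrite -big_split/=; apply: eq_bigr => i _.
by case: (lam i == _) => /=; rewrite ?addn0//; case: ltnP; lia.
Qed.

Lemma cnt_gtS (a : R) k : cnt_gt a k = (cnt_eq a k.+1 + cnt_gt a k.+1)%N.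
Proof.
rewrite -big_split/=; apply: eq_bigr => i _.
by case: (lam i == _) => //=; case: ltngtP; lia.
Qed.

Lemma even_neg_ranks_cnt :
  even_neg_ranks M <-> forall (a : R) k, a < 0 -> ~~ odd (cnt_gt a k).
Proof.
split=> H a k a0; have := H a k a0.
  by rewrite (rank_shift_cnt a k) oddD; case: odd; case: odd.
by rewrite (rank_shift_cnt a k) oddD; case: odd; case: odd.
Qed.

Lemma block_countE (a : R) i : lam i = a%:C%C -> block_count lam p i = cnt_eq a (p i).
Proof.
move=> li; rewrite /block_count cardsE -sum1_card big_mkcond/=.
by apply: eq_bigr => j _; rewrite unfold_in/= li; case: (_ && _).
Qed.

Lemma A_index_zero_ranks : A_index_of_jordan lam p = 0%N <-> even_neg_ranks M.
Proof.
rewrite even_neg_ranks_cnt; have [p0 _] := MJ; split.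
  move=> /eqP; rewrite /A_index_of_jordan sum_nat_eq0 => /forall_inP H a k a0.
  have ev q : ~~ odd (cnt_eq a q).
    have [/existsP[i Pi]|/existsPn nP] :=
        boolP [exists i, (lam i == a%:C%C) && (p i == q)]; last first.
      by rewrite /cnt_eq big1// => i _; rewrite (negbTE (nP i)).
    (* The first position carrying the pair (a, q) is the one that the index sums; an odd count
       would force its size, which is positive, to be zero. *)
    case: (@arg_minnP _ i (fun i => (lam i == a%:C%C) && (p i == q)) (fun i => val i) Pi) => i0 /andP[/eqP l0 /eqP q0] mn.
    apply/negP => od.
    suff : p i0 == 0%N by rewrite eqn0Ngt p0.
    apply: H; rewrite (block_countE l0) q0 od l0 ltcR a0 complex_real eqxx /=.
    apply/forallP => j; apply/implyP => ji; apply/negP => Pj.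
    by have := mn j Pj; rewrite leqNgt ji.
  (* Downward induction on [k], with [d] bounding the distance to the total size, where no larger
     block is left. *)
  have [d] : exists d, (\sum_i p i <= k + d)%N by exists (\sum_i p i)%N; rewrite leq_addl.
  elim: d k => [|d IH] k kd.
    rewrite /cnt_gt big1// => i _; case: ltnP => [|_]; rewrite ?andbF// => ki.
    by move: kd; rewrite (bigD1 i)//=; lia.
  by rewrite cnt_gtS oddD (negbTE (ev _)) IH// addSnnS.
move=> H; apply/eqP; rewrite sum_nat_eq0; apply/forall_inP => i /and4P[_ l0 + _].
(* In the order on complex numbers, being negative forces a zero imaginary part. *)
have [a a0 la] : exists2 a : R, a < 0 & lam i = a%:C%C.
  case: (lam i) l0 => x y; rewrite ltcE/= => /andP[/eqP <- x0].
  by exists x.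
rewrite (block_countE la); have := p0 i; case: (p i) => // q _.
by have := H a q a0; rewrite cnt_gtS oddD (negbTE (H _ _ a0)) addbF => /negbTE ->.
Qed.

End Counting.

(* On a complement of the image of N^(k+1) in that of N^k, where N = S^2 - a,
   the operator S induces X with X^2 = a; then (det X)^2 = a^d forces d to be even. *)
Lemma square_even_neg_ranks n (S : 'M[R]_n) : even_neg_ranks (S *m S).
Proof.
move=> a k a0; set N := S *m S - a%:M.
have SN : S *m N = N *m S.
  by rewrite mulmxBr mulmxBl mulmxA scalar_mxC.
pose V := N ^+ k.+1.
have SNk j : S *m N ^+ j = N ^+ j *m S by apply: expmx_comm.
pose W := row_base (N ^+ k :\: V)%MS.
have VN : (V <= N ^+ k)%MS by rewrite /V -mulmx_expr_l submxMl.
have WN : (W <= N ^+ k)%MS by rewrite eq_row_base diffmxSl.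
have [Y WY] := submxP WN.
have sum_sub (Z : 'M[R]_(\rank (N ^+ k :\: V), n)) : (Z <= N ^+ k)%MS ->
    exists X Z', Z = X *m W + Z' *m V.
  move=> ZN.
  have /sub_addsmxP[[X Z'] /= ->] : (Z <= W + V)%MS.
    apply: submx_trans ZN _; rewrite -(addsmx_diff_cap_eq (N ^+ k) V).
    by rewrite addsmxS ?eq_row_base// capmxSr.
  by exists X, Z'.
(* The rows of [W] are a basis of a complement of [V] in the row space of [N^k]; modulo [V], [S]
   acts on them by [X]. *)
have [X [Z WS]] : exists X Z', W *m S = X *m W + Z' *m V.
  by apply: sum_sub; rewrite WY -mulmxA -SNk mulmxA submxMl.
have cap0 : (W :&: V = 0)%MS.
  apply/eqP; rewrite -submx0 -(capmx_diff (N ^+ k) V) capmxS ?eq_row_base//.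
have XX : X *m X = a%:M.
  (* Computing [W S^2] through [X] in [e1] and through [S^2 = N + a] in [e2] puts [(X^2 - a) W]
     inside [V], which meets [W] only in 0. *)
  have : ((X *m X - a%:M) *m W <= W :&: V)%MS.
    rewrite sub_capmx submxMl/=.
    have e1 : W *m (S *m S) = X *m X *m W + (X *m Z + Z *m S) *m V.
      rewrite mulmxA WS mulmxDl -(mulmxA X W S) WS mulmxDr !mulmxA mulmxDl -!addrA.
      by congr (_ + (_ + _)); rewrite -!mulmxA SNk.
    have e2 : W *m (S *m S) = a *: W + Y *m V.
      rewrite -[S *m S](subrK a%:M) -/N mulmxDr mul_mx_scalar addrC.
      by rewrite {2}WY -mulmxA mulmx_expr_r.
    have -> : (X *m X - a%:M) *m W = (Y - (X *m Z + Z *m S)) *m V.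
      rewrite mulmxBl mul_scalar_mx mulmxBl.
      rewrite -[X in X - _](addrK ((X *m Z + Z *m S) *m V)) -e1 e2.
      by rewrite addrAC [a *: W + _]addrC addrK.
    by rewrite submxMl.
  rewrite cap0 submx0 => /eqP h.
  apply/eqP; rewrite -subr_eq0; apply/eqP.
  by apply: (row_free_inj (row_base_free _)); rewrite mul0mx; exact: h.
(* The size of [X] is the rank drop from [k] to [k.+1]; were it odd, the square of [det X] would be
   an odd power of [a], hence negative. *)
have /eqP := mxrank_cap_compl (N ^+ k) V.
have -> : \rank (N ^+ k :&: V)%MS = \rank V.
  by apply/eqP; rewrite eqn_leq !mxrankS ?capmxSr// sub_capmx VN submx_refl.
move=> /eqP <-; rewrite oddD -/V.
suff /negbTE -> : ~~ odd (\rank (N ^+ k :\: V)) by rewrite addbF.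
apply/negP => od.
have := sqr_ge0 (\det X); rewrite expr2 -det_mulmx XX det_scalar.
by rewrite leNgt exprn_odd_lt0// a0.
Qed.

End NegativeBlocks.

(** * Real logarithms from the parity condition *)

Section RealLogarithm.
Variable R : realType.

Lemma even_neg_ranks_sim n m (A : 'M[R]_n) (B : 'M[R]_m) :
  mxsim A B -> even_neg_ranks A -> even_neg_ranks B.
Proof. by move=> AB EA a k a0; rewrite -!(mxrank_shift_exp_sim _ _ AB) EA. Qed.

Lemma mexp_surj_sim n m (A : 'M[R]_n) (B : 'M[R]_m) :
  mxsim A B -> (exists L, mexp L = B) -> exists L, mexp L = A.
Proof.
move=> [P [Q [PQ QP ->]]] [L <-].
by exists (P *m L *m Q); exact: mexp_sim.
Qed.

Lemma mexp_doubled_jordan_block (a : R) k : a < 0 ->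
  exists L, mexp L = block_mx (jordan_block a k) 0 0 (jordan_block a k).
Proof.
move=> a0; set J := jordan_block a k; set D := block_mx J 0 0 J.
(* The blocks of [- D] have eigenvalue [- a > 0], so [mexp_log] applies to [- D]. *)
have uD (b : R) : b <= 0 -> - D - b%:M \in unitmx.
  move=> b0; rewrite -opprD -scaleN1r unitmxZ ?unitrN1//.
  have -> : D + b%:M = (D - (- b)%:M) ^+ 1 by rewrite expr1 raddfN/= opprK.
  rewrite -row_free_unit /row_free mxrank_block_shift_exp !expr1 jordan_block_shift.
  have /(jordan_block_unitmx k)/mxrank_unit -> // : a - - b != 0.
  by rewrite opprK lt_eqF//; lra.
have [L eL commL] := mexp_log uD.
(* [K] rotates the two copies into each other: it squares to -1, and it commutes with [D], hence
   with [L], because the diagonal blocks of [D] are equal. *)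
pose K : 'M[R]_(k + k) := block_mx 0 (- 1%:M) 1%:M 0.
have KD : K *m (- D) = - D *m K.
  rewrite mulmxN mulNmx; congr (- _).
  rewrite !mulmx_block !(mulmx0, mul0mx, addr0, add0r).
  by rewrite mulNmx mulmxN mul1mx mulmx1.
exists (pi *: K + L); rewrite mexpD.
  rewrite eL mexp_pi ?mulNmx ?mul1mx ?opprK//.
  rewrite mulmx_block !(mulmx0, mul0mx, addr0, add0r) mulNmx mulmxN mul1mx.
  by rewrite (scalar_mx_block k k) opp_block_mx oppr0.
by rewrite -scalemxAl -scalemxAr commL.
Qed.

Lemma real_logarithm n (M : 'M[R]_n) :
  M \in unitmx -> even_neg_ranks M -> exists L, mexp L = M.
Proof.
have [N] := ubnP n; elim: N n M => // N IH n M; rewrite ltnS => nN uM eM.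
have [[a [a0 nu]]|no] := pselect (exists a : R, a < 0 /\ M - a%:M \notin unitmx);
    last first.
  have [|L eL _] := @mexp_log R n M; last by exists L.
  move=> a; rewrite le_eqVlt => /predU1P[->|a0]; first by rewrite raddf0 subr0.
  by apply/negPn/negP => h; apply: no; exists a.
have [k [lt st]] := rank_exp_stabilizes nu.
have [n1 [M1 MM1]] := mxsim_split_jordan lt st.
have rJ j : \rank ((jordan_block a k.+1 - a%:M) ^+ j) = (k.+1 - j)%N.
  by rewrite jordan_block_shift subrr rank_jordan_block0_exp.
have r1 j : \rank ((M - a%:M) ^+ j) = (k.+1 - j + \rank ((M1 - a%:M) ^+ j))%N.
  by rewrite (mxrank_shift_exp_sim _ _ MM1) mxrank_block_shift_exp rJ.
have mono1 : (\rank ((M1 - a%:M) ^+ k.+1) <= \rank ((M1 - a%:M) ^+ k))%N.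
  by rewrite -mulmx_expr_l mxrankM_maxr.
(* Evenness provides a second block of the same maximal size. *)
have [n2 [M2 MM2]] : exists n2 (M2 : 'M[R]_n2),
    mxsim M1 (block_mx (jordan_block a k.+1) 0 0 M2).
  apply: mxsim_split_jordan; last first.
    by move: st; rewrite !r1 subnn (eqP (leqnSn k.+1 : _ - _ == 0)%N).
  (* The rank drop of [M] at [k] is one more than that of [M1]; the former is even, so the latter is
     odd and hence nonzero. *)
  have := eM a k a0; rewrite !r1 subnn subSnn add0n add1n /=.
  by rewrite ltn_neqAle mono1 andbT; case: eqP => // ->; case: odd.
set J := jordan_block a k.+1 in MM1 MM2 rJ.
have MD : mxsim M (block_mx (block_mx J 0 0 J) 0 0 M2).
  apply: mxsim_trans MM1 _; apply: mxsim_trans (mxsim_block (mxsim_refl J) MM2) _.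
  have := @block_mxA R _ _ _ _ _ _ J 0 0 0 J 0 0 0 M2.
  rewrite /= !row_mx0 !col_mx0 => ->.
  exact: mxsim_cast.
apply: (mexp_surj_sim MD).
have en := mxsim_dim MD.
have [L1 eL1] := mexp_doubled_jordan_block k.+1 a0.
have [|||L2 eL2] := IH n2 M2; first by lia.
(* The full rank of [M] is the sum of the ranks of the diagonal blocks, so each of them has full
   rank. *)
- have := mxsim_rank MD; rewrite !rank_diag_block_mx (mxrank_unit uM).
  have := rank_leq_row M2; have := rank_leq_row J.
  rewrite -row_free_unit /row_free => h1 h2 h3; apply/eqP; lia.
(* The two copies of [J] contribute equal ranks, which cancel modulo 2. *)
- move=> b j b0; have := even_neg_ranks_sim MD eM j b0.
  rewrite !mxrank_block_shift_exp !oddD !addbb !addFb; exact.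
by exists (block_mx L1 0 0 L2); rewrite mexp_block eL1 eL2.
Qed.

End RealLogarithm.

(** * Floquet normal forms and the monodromy matrix *)

Section Floquet.
Variables (R : realType) (n : nat) (T : R) (A : R -> 'M[R]_n).
Hypotheses (T_gt0 : 0 < T) (Ac : continuous_mx A) (Ap : periodic_mx T A).

Lemma fundamental_matrix_exists : exists Phi, fundamental_matrix A Phi.
Proof.
have [Phi Phid Phi0] := linear_ode_exists Ac; exists Phi; split => // t.
have [Psi uPsi inv] := linear_ode_inverse Ac.
by have := inv _ Phid t; rewrite Phi0 => /mulmx1_unit[].
Qed.

(** Periodicity of [A] makes the shifted matrix another solution, so it is [Phi] times a constant
    matrix, read off at 0. *)
Lemma fundamental_matrix_shift Phi t : fundamental_matrix A Phi ->
  Phi (t + T) = Phi t *m monodromy T Phi.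
Proof.
move=> [uPhi Phid].
have Psid s : mx_derive (fun u => Phi (u + T)) s (A s *m Phi (s + T)).
  move=> i j; rewrite -Ap.
  have dT : is_derive s 1 (fun u : R => u + T) 1.
    exact: is_derive_shift.
  have := @is_derive1_comp _ (fun u => Phi u i j) (fun u => u + T) s _ _ (Phid (s + T) i j) dT.
  by rewrite mulr1.
have := @linear_ode_eq_mulr _ _ A Phi (fun u => Phi (u + T)) Ac Phid Psid (uPhi 0) t.
by rewrite add0r.
Qed.

Lemma real_floquet_of_log Phi (B : 'M[R]_n) : fundamental_matrix A Phi ->
    mexp (T *: B) = monodromy T Phi ->
  exists P, periodic_mx T P /\ forall t, Phi t = P t *m mexp (t *: B).
Proof.
(* Over one period [Phi] gains the right factor [exp (T B)], which the second factor cancels. *)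
move=> fPhi eB; exists (fun t => Phi t *m mexp ((- t) *: B)); split.
  move=> t; rewrite (fundamental_matrix_shift t fPhi) -eB -mulmxA -mexp_scaleD.
  by congr (_ *m mexp (_ *: B)); ring.
by move=> t; rewrite -mulmxA -mexp_scaleD addNr scale0r mexp0 mulmx1.
Qed.

Lemma monodromy_of_real_floquet Phi (B : 'M[R]_n) P : Phi 0 \in unitmx ->
    periodic_mx T P -> (forall t, Phi t = P t *m mexp (t *: B)) ->
  monodromy T Phi = mexp (T *: B).
Proof.
move=> u0 Pp e.
have P0 : Phi 0 = P 0 by rewrite e scale0r mexp0 mulmx1.
by rewrite /monodromy (e T) -[T in P T]add0r Pp -P0 mulKmx.
Qed.

Lemma A_index_zero_ranks_monodromy : A_index_zero T A <->
  forall Phi, fundamental_matrix A Phi -> even_neg_ranks (monodromy T Phi).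
Proof.
split=> H Phi fPhi.
  have [m [lam [p J]]] := jordan_decomp_exists
    (map_mx (fun x : R => x%:C%C) (monodromy T Phi)).
  exact/(A_index_zero_ranks J)/(H Phi fPhi).
by move=> m lam p J; apply/(A_index_zero_ranks J)/H.
Qed.

Lemma real_floquet_of_A_index_zero : A_index_zero T A ->
  exists (Rm : 'M[R]_n) (Q : R -> 'M[R]_n), periodic_mx T Q /\
    fundamental_matrix A (fun t => Q t *m mexp (t *: Rm)).
Proof.
move=> /A_index_zero_ranks_monodromy H.
have [Phi fPhi] := fundamental_matrix_exists.
have uM : monodromy T Phi \in unitmx by rewrite unitmx_mul unitmx_inv !fPhi.1.
have [L eL] := real_logarithm uM (H _ fPhi).
have [|Q [Qp e]] := @real_floquet_of_log Phi (T^-1 *: L) fPhi.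
  by rewrite scalerA mulfV ?scale1r// gt_eqF.
exists (T^-1 *: L), Q; split => //.
by rewrite (_ : (fun t => _) = Phi)//; apply/funext => t; rewrite e.
Qed.

(** Two fundamental matrices differ by a constant right factor [C], and
    [Q e^(tR) C = (Q C) e^(t C^-1 R C)]. *)
Lemma real_floquet_transfer (Rm : 'M[R]_n) (Q Phi : R -> 'M[R]_n) :
    periodic_mx T Q -> fundamental_matrix A (fun t => Q t *m mexp (t *: Rm)) ->
    fundamental_matrix A Phi ->
  exists (B : 'M[R]_n) (P : R -> 'M[R]_n),
    periodic_mx T P /\ forall t, Phi t = P t *m mexp (t *: B).
Proof.
move=> Qp [uX Xd] [uPhi Phid].
have e := linear_ode_eq_mulr Ac Xd Phid (uX 0).
set C := invmx _ *m _ in e.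
have uC : C \in unitmx by rewrite unitmx_mul unitmx_inv uX uPhi.
clearbody C; exists (invmx C *m Rm *m C), (fun t => Q t *m C); split.
  by move=> t; rewrite Qp.
move=> t; rewrite e scalemxAl scalemxAr mexp_sim ?mulVmx ?mulmxV//.
by rewrite !mulmxA mulmxK.
Qed.

Lemma A_index_zero_of_real_floquet :
    (forall Phi, fundamental_matrix A Phi ->
       exists (B : 'M[R]_n) (P : R -> 'M[R]_n),
         periodic_mx T P /\ forall t, Phi t = P t *m mexp (t *: B)) ->
  A_index_zero T A.
Proof.
move=> H; apply/A_index_zero_ranks_monodromy => Phi /[dup] fPhi /H[B [P [Pp e]]].
(* Halving [T] exhibits the monodromy matrix as the square of the real matrix [exp (T B / 2)]. *)
rewrite (monodromy_of_real_floquet (fPhi.1 0) Pp e) (splitr T) mexp_scaleD.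
exact: square_even_neg_ranks.
Qed.

End Floquet.

Theorem theorem5p1 (R : realType) (n : nat) (T : R) (A : R -> 'M[R]_n) :
  0 < T -> continuous_mx A -> periodic_mx T A ->
  [/\ (A_index_zero T A ->
        exists (Rm : 'M[R]_n) (Q : R -> 'M[R]_n),
          periodic_mx T Q /\
          fundamental_matrix A (fun t => Q t *m mexp (t *: Rm))),
      ((exists (Rm : 'M[R]_n) (Q : R -> 'M[R]_n),
          periodic_mx T Q /\
          fundamental_matrix A (fun t => Q t *m mexp (t *: Rm))) ->
        forall Phi : R -> 'M[R]_n, fundamental_matrix A Phi ->
          exists (B : 'M[R]_n) (P : R -> 'M[R]_n),
            periodic_mx T P /\ forall t : R, Phi t = P t *m mexp (t *: B)) &
      ((forall Phi : R -> 'M[R]_n, fundamental_matrix A Phi ->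
          exists (B : 'M[R]_n) (P : R -> 'M[R]_n),
            periodic_mx T P /\ forall t : R, Phi t = P t *m mexp (t *: B)) ->
        A_index_zero T A)].
Proof.
move=> T_gt0 Ac Ap; split.
- exact: real_floquet_of_A_index_zero.
- by move=> [Rm [Q [Qp fQ]]] Phi; exact: real_floquet_transfer fQ.
- exact: A_index_zero_of_real_floquet.
Qed.
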